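(* Let $\nu^{0l}$ be a common eigenvector of the matrices $A_j$ corresponding to the eigenvalues $\lambda_l^j$, $j=1,\ldots,m$, and let $\nu^{\theta l}$, $\theta=1,\ldots,s_l-1$, be generalized eigenvectors of order $\theta$ of $A_\zeta$ corresponding to the eigenvalue $\lambda_l^\zeta$ with elementary divisor of multiplicity $s_l\ge2$. Let $v_{\theta l}^\zeta\colon\mathscr X\to\mathbb R$, $\theta=1,\ldots,s_l-1$, be the solution of $$\nu^{\theta l}x=\sum_{\delta=1}^\theta\binom{\theta-1}{\delta-1}v_{\delta l}^\zeta(x)\,\nu^{\theta-\delta,l}x,\quad\theta=1,\ldots,s_l-1,$$ on a domain $\mathscr X\subset\{x\colon\nu^{0l}x\ne0\}$. Assume that none of the functions $x\to\mathfrak p_jv_{\theta l}^\zeta(x)$, $j=1,\ldots,m$, $j\ne\zeta$, $\theta=1,\ldots,s_l-1$, is a (nonconstant) first integral of the ordinary differential system $dx=B_\zeta x\,dt_\zeta$. Put $\mu_{0l}^{j\zeta}=\lambda_l^j$ and $\mu_{\theta l}^{j\zeta}=\mathfrak p_jv_{\theta l}^\zeta(x)$ (constants), $\theta=1,\ldots,s_l-1$, $j=1,\ldots,m$. Then the completely solvable system $dx=\sum_{j=1}^m(B_jx+f_j(t))\,dt_j$ has the first integrals $$F_\theta\colon(t,x)\to\nu^{\theta l}x\cdot\varphi(t)-\sum_{\tau=1}^\theta K_{\tau-1}^\theta(t)\,F_{\tau-1}(t,x)-C_\theta(t)\quad\text{for all }(t,x)\in\widetilde{\mathcal T}\times\mathscr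 X,\quad\theta=0,\ldots,s_l-1,$$ where $\widetilde{\mathcal T}\subset\mathcal T$ is a simply connected domain and, on $\widetilde{\mathcal T}$, $$\varphi(t)=\exp\Bigl(-\sum_{j=1}^m\mu_{0l}^{j\zeta}t_j\Bigr),$$ $$K_{\tau-1}^\theta(t)=\int\sum_{j=1}^m\Bigl(\binom{\theta}{\tau-1}\mu_{\theta-\tau+1,l}^{j\zeta}+\sum_{\delta=1}^{\theta-\tau}\binom\theta\delta\mu_{\delta l}^{j\zeta}K_{\tau-1}^{\theta-\delta}(t)\Bigr)dt_j,\quad\tau=1,\ldots,\theta,\ \theta=1,\ldots,s_l-1,$$ $$C_\theta(t)=\int\sum_{j=1}^m\Bigl(\nu^{\theta l}f_j(t)\cdot\varphi(t)+\sum_{\tau=1}^\theta\binom\theta\tau\mu_{\tau l}^{j\zeta}C_{\theta-\tau}(t)\Bigr)dt_j,\quad\theta=0,\ldots,s_l-1.$$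
   Context: Let $x\in\mathbb R^n$, $t=(t_1,\ldots,t_m)\in\mathcal T$, with $\mathcal T\subset\mathbb R^m$ a domain. Let $A_1,\ldots,A_m$ be real $n\times n$ matrices, $B_j=A_j^T$, and $f_j\colon\mathcal T\to\mathbb R^n$ continuously differentiable, $j=1,\ldots,m$. The system in total differentials $dx=\sum_{j=1}^m(B_jx+f_j(t))dt_j$ is completely solvable when $A_jA_\zeta=A_\zeta A_j$ and $\partial_{t_\zeta}f_j(t)-B_\zeta f_j(t)=\partial_{t_j}f_\zeta(t)-B_jf_\zeta(t)$ for all $t\in\mathcal T$, $j,\zeta=1,\ldots,m$. Put $\mathfrak p_j(x)=\sum_{i=1}^n(B_jx)_i\partial_{x_i}$. For vectors, $\nu x=\sum_i\nu_ix_i$. The index $\zeta\in\{1,\ldots,m\}$ is fixed so that $A_\zeta$ has the smallest number of elementary divisors; a first integral of $dx=B_\zeta x\,dt_\zeta$ here means a nonconstant function annihilated by $\mathfrak p_\zeta$. If $\nu^{0l}$ is an eigenvector of $A_\zeta$ for $\lambda_l^\zeta$ with elementary divisor of multiplicity $s_l$, a nonzero vector $\nu^{\theta l}\in\mathbb C^n$ is a generalized eigenvector of order $\theta$ if $(A_\zeta-\lambda_l^\zeta E)\nu^{\theta l}=\theta\,\nu^{\theta-1,l}$, $\theta=1,\ldots,s_l-1$ ($E$ the identity matrix). The symbol $\int\omega$ for a 1-form $\omega$ on $\widetilde{\mathcal T}$ denotes a function whose differential is $\omega$; each of the functions $K_{\tau-1}^\theta$, $C_\theta$ is chosen once and the same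 choice is used throughout. A continuously differentiable function $F(t,x)$ is a first integral of the full system if $\partial_{t_j}F+\sum_{i=1}^n(B_jx+f_j(t))_i\,\partial_{x_i}F=0$ on its domain, $j=1,\ldots,m$. *)

(* Defs.v *)
From HB Require Import structures.
From mathcomp Require Import all_boot all_order all_algebra.
From mathcomp Require Import all_classical all_reals all_analysis.
From mathcomp Require Export complex.
Import Order.TTheory GRing.Theory Num.Theory.
Import numFieldNormedType.Exports.

Set Implicit Arguments.
Unset Strict Implicit.
Unset Printing Implicit Defensive.

Local Open Scope classical_set_scope.
Local Open Scope ring_scope.
Local Open Scope complex_scope.

Definition domain {V : topologicalType} (D : set V) : Prop :=
  [/\ D !=set0, open D & connected D].

(* For open sets, [connected] amounts to path-connected, so only the
   contractibility of loops has to be added.  The homotopy is relative to the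
   base point. *)
Definition simply_connected_domain {R : realType} {V : topologicalType}
    (D : set V) : Prop :=
  domain D /\
  forall g : R -> V,
    {within `[0, 1], continuous g} ->
    (forall s, s \in `[0, 1] -> D (g s)) ->
    g 0 = g 1 ->
    exists H : R * R -> V,
      [/\ {within `[0, 1] `*` `[0, 1], continuous H},
          forall u s, u \in `[0, 1] -> s \in `[0, 1] -> D (H (u, s)),
          forall s, s \in `[0, 1] -> H (0, s) = g s,
          forall s, s \in `[0, 1] -> H (1, s) = g 0 &
          forall u, u \in `[0, 1] -> H (u, 0) = g 0 /\ H (u, 1) = g 0].

(* Used for finite-dimensional V only, where continuity of every directional
   derivative is continuity of the differential. *)
Definition C1_on {R : realType} {V W : normedModType R} (D : set V)
    (g : V -> W) : Prop :=
  forall p, D p ->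
    differentiable g p /\ forall v : V, {for p, continuous (fun q => 'D_v g q)}.

(* R[i] carries no normed R-module structure in the library: complex-valued
   functions of real variables are differentiated through their real and
   imaginary parts. *)
Section ComplexValued.
Context {R : realType} {V : normedModType R}.
Implicit Type g : V -> R[i].

Definition re_fun g : V -> R := fun p => complex.Re (g p).
Definition im_fun g : V -> R := fun p => complex.Im (g p).

Definition cderive g (v p : V) : R[i] :=
  ('D_v (re_fun g) p) +i* ('D_v (im_fun g) p).

Definition cC1_on (D : set V) g : Prop :=
  C1_on D (re_fun g) /\ C1_on D (im_fun g).

Definition cdifferentiable g (p : V) : Prop :=
  differentiable (re_fun g) p /\ differentiable (im_fun g) p.

End ComplexValued.

Definition cexp {R : realType} (z : R[i]) : R[i] :=
  (expR (complex.Re z) * cos (complex.Im z)) +i*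
  (expR (complex.Re z) * sin (complex.Im z)).

Definition unitv {R : realType} {n : nat} (i : 'I_n) : 'cV[R]_n :=
  delta_mx i 0.

Definition cmx {R : realType} {p q : nat} (A : 'M[R]_(p, q)) : 'M[R[i]]_(p, q) :=
  map_mx (fun a : R => a%:C) A.

(* Bilinear: no conjugation. *)
Definition pairing {R : realType} {n : nat} (nu : 'cV[R[i]]_n)
    (x : 'cV[R]_n) : R[i] :=
  \sum_(i < n) nu i 0 * (x i 0)%:C.

(* A function g with dg = \sum_j w_j dt_j on D. *)
Definition primitive_on {R : realType} {m : nat} (D : set 'cV[R]_m)
    (g : 'cV[R]_m -> R[i]) (w : 'I_m -> 'cV[R]_m -> R[i]) : Prop :=
  forall t, D t ->
    cdifferentiable g t /\ forall j, cderive g (unitv j) t = w j t.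

Section ElementaryDivisors.
Context {R : realType} {n : nat}.
Variable A : 'M[R[i]]_n.

(* gcd of all k x k minors of X - A; repeated or permuted rows and columns only
   contribute zeros and sign changes. *)
Definition determinantal_divisor (k : nat) : {poly R[i]} :=
  \big[@gcdp R[i]/0]_(r : {ffun 'I_k -> 'I_n})
  \big[@gcdp R[i]/0]_(c : {ffun 'I_k -> 'I_n})
    \det (mxsub r c (char_poly_mx A)).

Definition invariant_factor (k : nat) : {poly R[i]} :=
  determinantal_divisor k.+1 %/ determinantal_divisor k.

Definition spectrum : seq R[i] :=
  undup (sval (closed_field_poly_normal (char_poly A))).

(* The powers of 'X - a exactly dividing the invariant factors, listed with
   repetition. *)
Definition elementary_divisors : seq {poly R[i]} :=
  flatten [seq [seq ('X - a%:P) ^+ mup a (invariant_factor k)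
                  | a <- spectrum & root (invariant_factor k) a]
             | k <- iota 0 n].

End ElementaryDivisors.

Definition generalized_eigenvectors {R : realType} {n : nat}
    (A : 'M[R[i]]_n) (lambda : R[i]) (s : nat) (nu : nat -> 'cV[R[i]]_n) :
    Prop :=
  forall theta, (1 <= theta < s)%N ->
    nu theta != 0 /\
    (A - lambda%:M) *m nu theta = theta%:R *: nu theta.-1.

Section LinearSystem.
Context {R : realType} {m n : nat}.
Variable A : 'I_m -> 'M[R]_n.

(* The operator p_j, with B_j = A_j^T. *)
Definition pop (j : 'I_m) (g : 'cV[R]_n -> R) (x : 'cV[R]_n) : R :=
  \sum_(i < n) ((A j)^T *m x) i 0 * 'D_(unitv i) g x.

Definition nonconstant_on (X : set 'cV[R]_n) (g : 'cV[R]_n -> R) : Prop :=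
  exists x y, [/\ X x, X y & g x <> g y].

(* First integrals on X of the ordinary system dx = B_j x dt_j. *)
Definition ode_first_integral (X : set 'cV[R]_n) (j : 'I_m)
    (g : 'cV[R]_n -> R) : Prop :=
  [/\ nonconstant_on X g, C1_on X g & forall x, X x -> pop j g x = 0].

Variable f : 'I_m -> 'cV[R]_m -> 'cV[R]_n.

Definition completely_solvable (T : set 'cV[R]_m) : Prop :=
  (forall j z, A j *m A z = A z *m A j) /\
  (forall j z t, T t ->
     'D_(unitv z) (f j) t - (A z)^T *m f j t =
     'D_(unitv j) (f z) t - (A j)^T *m f z t).

(* First integrals on D of dx = \sum_j (B_j x + f_j(t)) dt_j. *)
Definition first_integral (D : set ('cV[R]_m * 'cV[R]_n))
    (F : 'cV[R]_m * 'cV[R]_n -> R[i]) : Prop :=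
  cC1_on D F /\
  forall j t x, D (t, x) ->
    cderive F (unitv j, 0) (t, x) +
    \sum_(i < n) (((A j)^T *m x + f j t) i 0)%:C *
                 cderive F (0, unitv i) (t, x) = 0.

(* In the rest of the section, mu j theta stands for mu_{theta l}^{j zeta} and
   K p theta for K_p^theta. *)
Variable nu : nat -> 'cV[R[i]]_n.
Variable mu : 'I_m -> nat -> R[i].

Definition phi (t : 'cV[R]_m) : R[i] :=
  cexp (- \sum_(j < m) mu j 0%N * (t j 0)%:C).

Definition K_form (K : nat -> nat -> 'cV[R]_m -> R[i]) (tau theta : nat)
    (j : 'I_m) (t : 'cV[R]_m) : R[i] :=
  'C(theta, tau.-1)%:R * mu j (theta - tau).+1 +
  \sum_(1 <= delta < (theta - tau).+1)
    'C(theta, delta)%:R * mu j delta * K tau.-1 (theta - delta)%N t.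

Definition C_form (C : nat -> 'cV[R]_m -> R[i]) (theta : nat)
    (j : 'I_m) (t : 'cV[R]_m) : R[i] :=
  pairing (nu theta) (f j t) * phi t +
  \sum_(1 <= tau < theta.+1)
    'C(theta, tau)%:R * mu j tau * C (theta - tau)%N t.

Definition KC_primitives (D : set 'cV[R]_m) (s : nat)
    (K : nat -> nat -> 'cV[R]_m -> R[i]) (C : nat -> 'cV[R]_m -> R[i]) : Prop :=
  (forall theta tau, (1 <= theta < s)%N -> (1 <= tau <= theta)%N ->
     primitive_on D (K tau.-1 theta) (K_form K tau theta)) /\
  (forall theta, (theta < s)%N ->
     primitive_on D (C theta) (C_form C theta)).

Definition F_recursion (D : set 'cV[R]_m) (X : set 'cV[R]_n) (s : nat)
    (K : nat -> nat -> 'cV[R]_m -> R[i]) (C : nat -> 'cV[R]_m -> R[i])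
    (F : nat -> 'cV[R]_m * 'cV[R]_n -> R[i]) : Prop :=
  forall theta t x, (theta < s)%N -> D t -> X x ->
    F theta (t, x) =
      pairing (nu theta) x * phi t
      - \sum_(1 <= tau < theta.+1) K tau.-1 theta t * F tau.-1 (t, x)
      - C theta t.

End LinearSystem.

(* Main.v *)
From HB Require Import structures.
Require Import Defs.
From mathcomp Require Import all_boot all_order all_algebra.
From mathcomp Require Import all_classical all_reals all_analysis.
From mathcomp Require Import ring lra zify.
Import Order.TTheory GRing.Theory Num.Theory.
Import numFieldNormedType.Exports.

(** The binomial sums of the theorem are products of exponential generating
    functions: the binomial convolution [conv a b] of two sequences holds the
    coefficients of the product of their generating functions, and shifting a
    sequence differentiates its generating function with respect to the formal
    variable.  Put l_k(x) = nu^k x.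

    The relation that defines the v_theta says l' = v' l, so that v is the
    logarithm of l / l_0, and applying p_j to it gives
    (p_j l)' = (p_j v)' l + v' (p_j l).  Such an equation has one solution with
    a given first term ([conv_log_derivative]), whence p_j l = mu_j l with
    mu_j = lambda_j + p_j v ([A_nu_conv]).  For j = zeta the generalized
    eigenvectors yield p_zeta v_1 = 1 and p_zeta v_theta = 0 for theta > 1
    ([pop_zeta_v]).  As the matrices commute, p_zeta annihilates every
    p_j v_theta ([pop_zeta_pop_v]); by assumption this function is no
    nonconstant first integral, so it is constant ([pop_v_constant]).  Finally
    p_j l = mu_j l is an identity between linear functions of x on an open set,
    hence an identity between the vectors A_j nu^k and nu^i ([pairing_A_nu]).

    Let mu_j^+ be mu_j without its first term.  After setting K_p^p = 1 and
    K_p^k = 0 for k < p, the forms of the theorem read dK_p = mu^+ K_p and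
    dC = nu f phi + mu^+ C.  They are closed, for K because convolutions
    commute ([convCA]) and for C by complete solvability ([source_curl]).  If
    D_j is the derivation of functions of (t, x) along the j-th vector field of
    the system, then E = (nu x) phi - C satisfies D_j E = mu_j^+ E
    ([derive_E]), while the recursion for F says E_k = \sum_p K_p^k F_p.
    Differentiating this unitriangular relation leaves
    \sum_p K_p^k D_j F_p = 0, so all D_j F_k vanish by induction
    ([F_C1_and_derive]).

    The primitives exist by the Poincare lemma for simply connected domains
    ([poincare]).  On a ball one integrates along radii and differentiates
    under the integral sign ([local_primitive]).  A closed form thus has an
    increment between any two points of a ball contained in the domain, and
    these increments are added along chains of points.  The sum along a closed
    chain is zero ([loop_chain_sum0]): the closed polygon through the chain is
    contracted by a homotopy, the square on which the homotopy lives is cut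
    into cells so small that each one is sent into a ball ([lebesgue_number]),
    the increments around a cell cancel, so that all rows of the grid have the
    same sum, and the last row is constant ([grid_row_sum]).  The sum along any
    chain from a base point is therefore a primitive. *)

Local Open Scope classical_set_scope.
Local Open Scope ring_scope.
Local Open Scope complex_scope.

(** * Differentiability *)

Section Differentiability.
Context {R : realType}.

(** The differential ['d g x] is defined by a choice operator; this criterion
    recognizes differentiability from a candidate differential. *)
Lemma differentiable_of_bound (V W : normedModType R) (g : V -> W) (x : V)
    (df : {linear V -> W}) :
  continuous df ->
  (forall e : R, 0 < e ->
     \forall h \near 0, `|g (h + x) - g x - df h| <= e * `|h|) ->
  differentiable g x.
Proof.
move=> cdf gdf.
have ax : g \o shift x = cst (g x) + df +o_ 0 id.
  apply/eqaddoP => e e0; have := gdf e e0; apply: filterS => h.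
  by rewrite !fctE /= opprD addrA.
by apply/diff_locallyP; rewrite (diff_unique cdf ax).
Qed.

Lemma near_differentiable (V W : normedModType R) (f g : V -> W) (x : V) :
  {near x, f =1 g} -> differentiable f x -> differentiable g x.
Proof.
move=> fg df; apply: (@differentiable_of_bound _ _ _ _ ('d f x)).
  exact: diff_continuous.
move=> e e0; have := diff_locally df; move/eqaddoP => /(_ e e0) fe.
have fgx : f x = g x := nbhs_singleton fg.
have fgh : \forall h \near 0, f (h + x) = g (h + x).
  have : h + x @[h --> 0] --> 0 + x by apply: cvgD; [exact: cvg_id|exact: cvg_cst].
  by rewrite add0r => H; exact: (H _ fg).
apply: filterS2 fgh fe => h <-.
by rewrite !fctE /= -fgx -addrA -opprD.
Qed.

(** Directional derivatives are derivatives of restrictions to lines, so the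
    one-variable mean value theorem and the one-variable integral apply to
    them. *)
Lemma is_derive_lineE (V W : normedModType R) (g : V -> W) (p u : V) (h : R)
    (d : W) :
  is_derive h 1 (fun k : R => g (p + k *: u)) d <-> is_derive (p + h *: u) u g d.
Proof.
have E : (fun k : R => k^-1 *: (((fun k => g (p + k *: u)) \o shift h)
            (k *: 1) - g (p + h *: u))) =
         (fun k => k^-1 *: ((g \o shift (p + h *: u)) (k *: u)
            - g (p + h *: u))).
  apply/funext => k /=; congr (_ *: (g _ - _)).
  by rewrite scalerDl [k%:A]mulr1 addrCA.
have dE : derivable (fun k : R => g (p + k *: u)) h 1 =
          derivable g (p + h *: u) u by rewrite /derivable E.
have DE : 'D_1 (fun k : R => g (p + k *: u)) h = 'D_u g (p + h *: u).
  by rewrite /derive E.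
by split=> -[]; rewrite ?dE ?DE => dg Dg; apply: DeriveDef; rewrite ?dE ?DE.
Qed.

Lemma is_derive_diff_line (V W : normedModType R) (g : V -> W) (p u : V)
    (h : R) :
  differentiable g (p + h *: u) ->
  is_derive h 1 (fun k => g (p + k *: u)) ('D_u g (p + h *: u)).
Proof.
by move=> dg; apply/is_derive_lineE; apply: DeriveDef => //; exact: diff_derivable.
Qed.

Lemma derive_coord (W : normedModType R) m (g : 'cV[R]_m -> W) (t u : 'cV[R]_m) :
  differentiable g t -> 'D_u g t = \sum_(j < m) u j 0 *: 'D_(unitv j) g t.
Proof.
move=> dg; rewrite deriveE // [in LHS](matrix_sum_delta u) linear_sum /=.
apply: eq_bigr => j _; rewrite big_ord1 linearZ /= deriveE //.
Qed.

End Differentiability.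

Lemma cvg_sum (R : realType) (W : normedModType R) (I T : Type) (r : seq I)
    (P : pred I) (F : set_system T) (f : I -> T -> W) (a : I -> W) :
  Filter F -> (forall i, P i -> f i x @[x --> F] --> a i) ->
  \sum_(i <- r | P i) f i x @[x --> F] --> \sum_(i <- r | P i) a i.
Proof. by move=> FF fa; apply: cvg_big => //; exact: add_continuous. Qed.

(** * Integrals over the unit interval *)

Section IntegralsOnUnitInterval.
Context {R : realType}.
Notation mu := (@lebesgue_measure R).

Lemma continuous_integrable_unit (p : R -> R) :
  (forall s, 0 <= s <= 1 -> {for s, continuous p}) ->
  mu.-integrable `[0, 1] (EFin \o p).
Proof.
move=> cp; apply: continuous_compact_integrable; first exact: segment_compact.
by apply: continuous_in_subspaceT => s; rewrite inE /= in_itv; exact: cp.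
Qed.

Lemma integral_of_derivative (P p : R -> R) :
  (forall s : R, 0 <= s <= 1 -> is_derive s 1 P (p s)) ->
  (forall s, 0 <= s <= 1 -> {for s, continuous p}) ->
  \int[mu]_(s in `[0, 1]) p s = P 1 - P 0.
Proof.
move=> dP cp.
have cP (s : R) : 0 <= s <= 1 -> {for s, continuous P}.
  move=> /dP [dPs _]; apply: differentiable_continuous.
  exact/derivable1_diffP.
rewrite /Rintegral (@continuous_FTC2 _ p P) //.
- by apply: continuous_in_subspaceT => s; rewrite inE /= in_itv; exact: cp.
- split=> [s||].
  + by rewrite in_itv /= => /andP[s0 s1]; have [] := dP s; rewrite ?ltW.
  + by apply: cvg_at_right_filter; apply: cP; rewrite lexx ler01.
  + by apply: cvg_at_left_filter; apply: cP; rewrite lexx ler01.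
- move=> s; rewrite in_itv /= => /andP[s0 s1]; rewrite derive1E.
  by have [] := dP s; rewrite ?ltW.
Qed.

End IntegralsOnUnitInterval.

(** * One-forms and their primitives on balls *)

Section OneForms.
Context {R : realType} {m : nat}.
Implicit Types (w : 'I_m -> 'cV[R]_m -> R) (t u : 'cV[R]_m).

Definition form w t u : R := \sum_(j < m) w j t * u j 0.

Lemma form_is_linear w t : linear (form w t : 'cV[R]_m -> R).
Proof.
move=> a u v; rewrite /form scaler_sumr -big_split /=; apply: eq_bigr => j _.
by rewrite !mxE /GRing.scale /=; ring.
Qed.

Lemma form_unitv w t j : form w t (unitv j) = w j t.
Proof.
rewrite /form (bigD1 j) //= big1 ?addr0 => [|i ij].
  by rewrite /unitv mxE !eqxx mulr1.
by rewrite /unitv mxE (negbTE ij) mulr0.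
Qed.

HB.instance Definition _ w t :=
  GRing.isLinear.Build R 'cV[R]_m R *:%R (form w t) (form_is_linear w t).

Lemma coord_le_norm u j : `|u j 0| <= `|u|.
Proof.
rewrite [`|u|]mx_normrE; exact: (le_bigmax _ (fun ij => `|u ij.1 ij.2|) (j, 0)).
Qed.

(** The factor m comes from the norm of a column being the largest absolute
    value of its entries. *)
Lemma form_le_norm w t u (e : R) :
  (forall j, `|w j t| <= e) -> `|form w t u| <= m%:R * e * `|u|.
Proof.
move=> we; apply: (le_trans (ler_norm_sum _ _ _)).
apply: (@le_trans _ _ (\sum_(j < m) e * `|u|)); last first.
  by rewrite sumr_const card_ord -mulrA mulr_natl.
by apply: ler_sum => j _; rewrite normrM ler_pM // coord_le_norm.
Qed.

(** Continuity of the partial derivatives gives differentiability: by the mean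
    value theorem g(t + h) - g(t) is the value at h of the form taken at some
    point of the segment, and this form is close to the one at t. *)
Lemma gateaux_differentiable (D : set 'cV[R]_m) (g : 'cV[R]_m -> R) w :
  open D ->
  (forall t, D t -> forall u, is_derive t u g (form w t u)) ->
  (forall t, D t -> forall j, {for t, continuous (w j)}) ->
  forall t, D t -> differentiable g t.
Proof.
move=> oD dg cw t Dt.
pose L : {linear 'cV[R]_m -> R} := form w t.
have cL : continuous L.
  move=> u; apply: (@cvg_sum R R _ _ _ _ (nbhs u) (fun j y => w j t * y j 0)).
  move=> j _; apply: cvgM; first exact: cvg_cst.
  exact: (@coord_continuous R).
apply: (@differentiable_of_bound _ _ _ g t L cL) => e e0.
(* m + 1 rather than m, which may be 0 *)
have e1 : 0 < e / m.+1%:R by rewrite divr_gt0.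
have near_w : \forall y \near t, forall j, `|w j y - w j t| <= e / m.+1%:R.
  apply: (@filter_forall _ _ (fun j y => `|w j y - w j t| <= e / m.+1%:R)
    (nbhs t)) => j; have /cvgrPdist_le /(_ _ e1) := cw t Dt j.
  by apply: filterS => y; rewrite distrC.
have [r /= r0 tr] : exists2 r : R, 0 < r & forall y, `|y - t| < r ->
    D y /\ forall j, `|w j y - w j t| <= e / m.+1%:R.
  have : \forall y \near t, D y /\ forall j, `|w j y - w j t| <= e / m.+1%:R.
    by apply: filterI => //; exact: open_nbhs_nbhs.
  move=> /nbhs_normP [r r0 tr].
  by exists r => // y yt; apply: tr; rewrite /ball_ /= distrC.
apply/nbhs_norm0P; exists r => // h /= hr.
have on_line (s : R) : 0 <= s <= 1 -> D (t + s *: h) /\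
    forall j, `|w j (t + s *: h) - w j t| <= e / m.+1%:R.
  move=> /andP[s0 s1]; apply: tr; rewrite addrC addKr normrZ ger0_norm //.
  by rewrite (le_lt_trans _ hr) // ler_piMl.
have dline (s : R) : 0 <= s <= 1 ->
    is_derive s (1 : R) (fun k : R => g (t + k *: h)) (form w (t + s *: h) h).
  by move=> s01; apply/is_derive_lineE; apply: dg; have [] := on_line s s01.
have [s||s s01] := @MVT_segment R (fun k : R => g (t + k *: h))
  (fun s : R => form w (t + s *: h) h) 0 1 ler01.
  by rewrite in_itv /= => /andP[s0 s1]; apply: dline; rewrite !ltW.
  apply: derivable_within_continuous => s; rewrite in_itv /= => s01.
  by have [] := dline s s01.
rewrite subr0 mulr1 scale1r scale0r addr0 [h + t]addrC => ->.
have -> : form w (t + s *: h) h - form w t h =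
          form (fun j y => w j y - w j t) (t + s *: h) h.
  by rewrite /form -sumrB; apply: eq_bigr => j _; rewrite mulrBl.
rewrite in_itv /= in s01.
have [_ le_w] := on_line s s01.
apply: (le_trans (@form_le_norm (fun j y => w j y - w j t) _ h _ le_w)).
rewrite ler_wpM2r // mulrCA ger_pMr // ler_pdivrMr // mul1r ler_nat //.
Qed.

Definition primitive (D : set 'cV[R]_m) w (g : 'cV[R]_m -> R) : Prop :=
  forall t, D t -> differentiable g t /\ forall u, 'D_u g t = form w t u.

(** Closedness is assumed for the vectors of the standard basis; bilinearity
    extends it to two arbitrary directions. *)
Lemma form_closed w t u z :
  (forall j, differentiable (w j) t) ->
  (forall i j, 'D_(unitv i) (w j) t = 'D_(unitv j) (w i) t) ->
  \sum_(j < m) 'D_z (w j) t * u j 0 = \sum_(j < m) 'D_u (w j) t * z j 0.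
Proof.
move=> dw cw.
transitivity (\sum_(j < m) \sum_(i < m) z i 0 * 'D_(unitv i) (w j) t * u j 0).
  by apply: eq_bigr => j _; rewrite derive_coord // big_distrl.
rewrite exchange_big; apply: eq_bigr => i _; rewrite derive_coord // big_distrl.
by apply: eq_bigr => j _; rewrite cw /GRing.scale /=; ring.
Qed.

Section LocalPrimitive.
Variables (c : 'cV[R]_m) (r : R) (w : 'I_m -> 'cV[R]_m -> R).
Hypothesis w_C1 : forall j, C1_on (ball c r) (w j).
Hypothesis w_closed : forall i j t, ball c r t ->
  'D_(unitv i) (w j) t = 'D_(unitv j) (w i) t.

(** The integral of the form along the segment from c to t. *)
Definition radial_integral t : R :=
  \int[@lebesgue_measure R]_(s in `[0, 1]) form w (c + s *: (t - c)) (t - c).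

Lemma ball_radial t (s : R) : ball c r t -> 0 <= s <= 1 ->
  ball c r (c + s *: (t - c)).
Proof.
rewrite -ball_normE /ball_ /= => ct /andP[s0 s1].
rewrite opprD addNKr normrN normrZ ger0_norm // (le_lt_trans _ ct) //.
by rewrite [`|c - t|]distrC ler_piMl.
Qed.

Let ray t u (p : R * R) := c + p.2 *: (t + p.1 *: u - c).

Lemma ray_continuous t u : continuous (ray t u).
Proof.
move=> p; rewrite /ray; apply: cvgD; first exact: cvg_cst.
apply: cvgZ; first exact: cvg_snd.
apply: cvgB; last exact: cvg_cst.
apply: cvgD; first exact: cvg_cst.
by apply: cvgZ; [exact: cvg_fst | exact: cvg_cst].
Qed.

Let integrand t u (p : R * R) := form w (ray t u p) (t + p.1 *: u - c).

Let dintegrand t u (p : R * R) :=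
  \sum_(j < m) (p.2 * 'D_u (w j) (ray t u p) * (t + p.1 *: u - c) j 0 +
                w j (ray t u p) * u j 0).

Lemma ray_comp_continuous t u p (g : 'cV[R]_m -> R) :
  {for ray t u p, continuous g} -> {for p, continuous (g \o ray t u)}.
Proof. by move=> cg; apply: continuous_comp cg; exact: ray_continuous. Qed.

Lemma coord_ray_continuous t u j :
  continuous (fun p : R * R => (t + p.1 *: u - c) j 0).
Proof.
move=> p; apply: (@continuous_comp _ _ _ (fun p : R * R => t + p.1 *: u - c)
  (fun z => z j 0)); last exact: (@coord_continuous R).
apply: cvgB; last exact: cvg_cst.
apply: cvgD; first exact: cvg_cst.
by apply: cvgZ; [exact: cvg_fst | exact: cvg_cst].
Qed.

Lemma dintegrand_continuous t u p : ball c r (ray t u p) ->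
  {for p, continuous (dintegrand t u)}.
Proof.
move=> ball_ray.
apply: (@cvg_sum R R _ _ _ _ (nbhs p) (fun j q =>
  q.2 * 'D_u (w j) (ray t u q) * (t + q.1 *: u - c) j 0 + w j (ray t u q) * u j 0)).
move=> j _; have [dw cw] := w_C1 j _ ball_ray; apply: cvgD; apply: cvgM.
- apply: cvgM; first exact: cvg_snd.
  exact: (@ray_comp_continuous t u p (fun q => 'D_u (w j) q)).
- exact: coord_ray_continuous.
- apply: (@ray_comp_continuous t u p (w j)); exact: differentiable_continuous.
- exact: cvg_cst.
Qed.

Lemma integrand_continuous t u p : ball c r (ray t u p) ->
  {for p, continuous (integrand t u)}.
Proof.
move=> ball_ray.
apply: (@cvg_sum R R _ _ _ _ (nbhs p) (fun j q =>
  w j (ray t u q) * (t + q.1 *: u - c) j 0)).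
move=> j _; have [dw _] := w_C1 j _ ball_ray; apply: cvgM;
  last exact: coord_ray_continuous.
by apply: (@ray_comp_continuous t u p (w j)); exact: differentiable_continuous.
Qed.

Lemma integrand_derive t u (h s : R) : ball c r (ray t u (h, s)) ->
  is_derive h 1 (fun k : R => integrand t u (k, s)) (dintegrand t u (h, s)).
Proof.
move=> ball_ray.
have rayE (k : R) : ray t u (k, s) = c + s *: (t - c) + k *: (s *: u).
  by apply/matrixP => i l; rewrite /ray !mxE /=; ring.
have -> : (fun k : R => integrand t u (k, s)) =
    \sum_(j < m) ((fun k : R => w j (c + s *: (t - c) + k *: (s *: u))) *
                  (fun k : R => (t - c) j 0 + k * u j 0)).
  apply/funext => k; rewrite fct_sumE; apply: eq_bigr => j _.
  rewrite (_ : (t + (k, s).1 *: u - c) j 0 = (t - c) j 0 + k * u j 0) ?rayE //.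
  by rewrite !mxE /=; ring.
rewrite /dintegrand; apply: is_derive_sum => j.
have dz : is_derive h 1 (fun k : R => (t - c) j 0 + k * u j 0) (u j 0).
  apply: is_derive_eq.
  by rewrite /GRing.scale /=; ring.
have [dw _] := w_C1 j _ ball_ray.
have dw' : is_derive h 1 (fun k : R => w j (c + s *: (t - c) + k *: (s *: u)))
    (s * 'D_u (w j) (ray t u (h, s))).
  have -> : s * 'D_u (w j) (ray t u (h, s)) = 'D_(s *: u) (w j) (ray t u (h, s)).
    by rewrite !deriveE // linearZ.
  by rewrite rayE; apply: is_derive_diff_line; rewrite -rayE.
apply: is_derive_eq; rewrite -rayE /GRing.scale /= addrC.
by rewrite addrAC !mxE; ring.
Qed.

Lemma continuous_pair_l (h s : R) : {for s, continuous (fun s : R => (h, s))}.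
Proof.
apply: (@cvg_pair _ _ _ (nbhs s) (nbhs h) (nbhs s) _ _ _ (cst h) id); first exact: cvg_cst.
exact: cvg_id.
Qed.

(** The derivative of the radial integrand in the direction u contains the
    derivatives of w in the direction u.  Closedness exchanges this direction
    with the radial one, which makes the integrand an exact derivative in s. *)
Lemma integral_dintegrand0 t u : ball c r t ->
  \int[@lebesgue_measure R]_(s in `[0, 1]) dintegrand t u (0, s) = form w t u.
Proof.
move=> ct; pose P (s : R) := s * form w (ray t u (0, s)) u.
have rayE (s : R) : ray t u (0, s) = c + s *: (t - c).
  by rewrite /ray /= scale0r addr0.
have ball_ray (s : R) : 0 <= s <= 1 -> ball c r (ray t u (0, s)).
  by rewrite rayE; exact: ball_radial.
transitivity (P 1 - P 0); last first.
  by rewrite /P mul1r mul0r subr0 rayE scale1r addrC subrK.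
(* By closedness, the derivative in the direction u of the radial integrand
   is the derivative of s |-> s w(c + s (t - c)) u, the function P. *)
apply: integral_of_derivative => s s01.
- have -> : P = \sum_(j < m) (id * ((fun k : R => w j (c + k *: (t - c)))
                  * cst (u j 0)) : R -> R).
    apply/funext => k; rewrite fct_sumE /P /form big_distrr /=.
    by apply: eq_bigr => j _; rewrite rayE.
  have -> : dintegrand t u (0, s) = \sum_(j < m)
      (s * ('D_(t - c) (w j) (ray t u (0, s)) * u j 0) + w j (ray t u (0, s)) * u j 0).
    rewrite /dintegrand /= !big_split /=; congr (_ + _).
    rewrite -big_distrr /= (@form_closed w (ray t u (0, s)) u (t - c)).
    + rewrite scale0r addr0 big_distrr /=.
      by apply: eq_bigr => j _; rewrite mulrA.
    + by move=> j; have [] := w_C1 j _ (ball_ray s s01).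
    + by move=> i j; apply: w_closed; exact: ball_ray.
  apply: is_derive_sum => j.
  have dw : is_derive s 1 (fun k : R => w j (c + k *: (t - c)))
      ('D_(t - c) (w j) (ray t u (0, s))).
    rewrite rayE; apply: is_derive_diff_line; rewrite -rayE.
    by have [] := w_C1 j _ (ball_ray s s01).
  have d := is_deriveM (is_derive_id s 1) (is_deriveM dw (is_derive_cst (u j 0) s 1)).
  apply: (is_derive_eq d); rewrite rayE !fctE /GRing.scale /=.
  by rewrite mulr0 add0r mulr1 [u j 0 * _]mulrC.
- apply: (@continuous_comp _ _ _ (fun s : R => (0 : R, s)) (dintegrand t u)).
    exact: continuous_pair_l.
  by apply: dintegrand_continuous; exact: ball_ray.
Qed.

(** Differentiation under the integral sign needs a bound of the derivative of
    the integrand that does not depend on the parameter; it comes from the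
    compactness of a rectangle of parameters. *)
Lemma radial_integral_derive t u : ball c r t ->
  is_derive t u radial_integral (form w t u).
Proof.
move=> ct.
have r0 : 0 < r by move: ct; rewrite -ball_normE; exact: le_lt_trans.
have [e e0 Be] : exists2 e : R, 0 < e &
    forall h, `|h| <= e -> ball c r (t + h *: u).
  have : \forall h \near (0 : R), ball c r (t + h *: u).
    have ct' : t + h *: u @[h --> (0 : R)] --> t + 0 *: u.
      by apply: cvgD; [exact: cvg_cst | apply: cvgZ; [exact: cvg_id | exact: cvg_cst]].
    rewrite scale0r addr0 in ct'; apply: ct'; apply: open_nbhs_nbhs; split => //.
    exact: ball_open.
  move=> /nbhs_norm0P [e /= e0 Be]; exists (e / 2); first by rewrite divr_gt0.
  by move=> h he; apply: Be => /=; rewrite (le_lt_trans he) // gtr_pMr // invf_lt1 ?ltr1n.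
have ball_ray (h s : R) : `|h| <= e -> 0 <= s <= 1 -> ball c r (ray t u (h, s)).
  by move=> he s01; apply: ball_radial => //; exact: Be.
have [M M0 dintegrand_bound] : exists2 M : R, 0 < M &
    forall h s : R, `|h| <= e -> 0 <= s <= 1 -> `|dintegrand t u (h, s)| < M.
  have cK : compact (`[- e, e]%classic `*` `[(0 : R), 1]%classic).
    by apply: compact_setX; exact: segment_compact.
  have : compact (dintegrand t u @` (`[- e, e]%classic `*` `[(0 : R), 1]%classic)).
    apply: continuous_compact cK; apply: continuous_in_subspaceT => -[h s].
    rewrite inE /= !in_itv /= => -[he s01]; apply: dintegrand_continuous.
    by apply: ball_ray => //; rewrite ler_norml.
  move=> /compact_bounded /ex_strict_bound_gt0 [M M0 HM]; exists M => // h s he s01.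
  apply: HM; exists (h, s) => //=; rewrite !in_itv /=; split => //.
  by rewrite -ler_norml.
pose f (h s : R) := integrand t u (h, s).
have dfE (h s : R) : `|h| <= e -> 0 <= s <= 1 ->
    is_derive h 1 (f ^~ s) (dintegrand t u (h, s)).
  by move=> he s01; apply: integrand_derive; exact: ball_ray.
have intf (h : R) : `|h| <= e ->
    (@lebesgue_measure R).-integrable `[0, 1] (EFin \o f h).
  move=> he; apply: continuous_integrable_unit => s s01.
  apply: (@continuous_comp _ _ _ (fun s : R => (h, s)) (integrand t u)).
    exact: continuous_pair_l.
  by apply: integrand_continuous; exact: ball_ray.
have Ie (h : R) : `]- e, e[%classic h -> `|h| <= e.
  by rewrite /= in_itv /= -ltr_norml => /ltW.
have I0 : `]- e, e[%classic (0 : R) by rewrite /= in_itv /= oppr_lt0 e0.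
have intM : (@lebesgue_measure R).-integrable `[0, 1] (EFin \o cst M).
  by apply: continuous_integrable_unit => s _; exact: cvg_cst.
have derf (h s : R) : `]- e, e[%classic h ->
    `[0, 1]%classic s -> derivable (f ^~ s) h 1.
  by move=> /Ie he; rewrite /= in_itv /= => s01; have [] := dfE h s he s01.
have ubf (h s : R) : `]- e, e[%classic h ->
    `[0, 1]%classic s -> `|partial1of2 f h s| <= M.
  move=> /Ie he; rewrite /= in_itv /= => s01; rewrite partial1of2E.
  by have [_ ->] := dfE h s he s01; rewrite ltW // dintegrand_bound.
have mI : measurable (`[(0 : R), 1]%classic : set (measurableTypeR R)) by [].
have intf' (h : R) : `]- e, e[%classic h ->
    (@lebesgue_measure R).-integrable `[0, 1] (EFin \o f h).
  by move=> /Ie; exact: intf.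
have M0' : forall s : R, 0 <= cst M s by move=> s; exact: ltW.
have dG := @derivable_under_integral R _ _ (@lebesgue_measure R) f _ mI _ _ _ I0
   intf' derf _ M0' intM ubf.
have DG := @differentiation_under_integral R _ _ (@lebesgue_measure R) f _ mI _ _ _ I0
   intf' derf _ M0' intM ubf.
have {DG} DG : 'D_1 (fun h => \int[@lebesgue_measure R]_(s in `[0, 1]) f h s) 0 =
    form w t u.
  rewrite -derive1E DG -(@integral_dintegrand0 t u ct); apply: eq_Rintegral => s.
  rewrite inE /= in_itv /= => s01; rewrite partial1of2E.
  by have [_ ->] := dfE 0 s (Ie _ I0) s01.
have E : (fun h : R => \int[@lebesgue_measure R]_(s in `[0, 1]) f h s) =
    (fun h : R => radial_integral (t + h *: u)) by [].
rewrite -[t]addr0 -[X in t + X](scale0r u); apply/is_derive_lineE; rewrite -E.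
rewrite scale0r addr0; exact: (@DeriveDef _ _ _ _ _ _ _ dG DG).
Qed.

Lemma local_primitive : primitive (ball c r) w radial_integral.
Proof.
move=> t ct.
have d t' : ball c r t' -> forall u, is_derive t' u radial_integral (form w t' u).
  by move=> ct' u; exact: radial_integral_derive.
split; last by move=> u; have [] := d t ct u.
apply: (@gateaux_differentiable (ball c r) radial_integral w _ d) => //.
  by apply: ball_open; move: ct; rewrite -ball_normE; exact: le_lt_trans.
move=> t' ct' j.
by apply: differentiable_continuous; have [] := w_C1 j _ ct'.
Qed.

End LocalPrimitive.

End OneForms.

(** * Polygonal paths *)

Section Polyline.
Set Implicit Arguments.
Unset Strict Implicit.
Context {R : realType} {W : normedModType R}.

Definition clamp (x : R) : R := Num.max 0 (Num.min 1 x).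

(** A closed formula for the polygon through c 0, ..., c k with k equal time
    steps: the i-th edge is travelled while its clamped coefficient grows from 0
    to 1.  Continuity is then immediate. *)
Definition polyline (c : nat -> W) k (s : R) : W :=
  c 0%N + \sum_(0 <= i < k) clamp (k%:R * s - i%:R) *: (c i.+1 - c i).

Lemma clamp_le0 x : x <= 0 -> clamp x = 0.
Proof. by move=> x0; rewrite /clamp max_l // ge_min x0 orbT. Qed.

Lemma clamp_ge1 x : 1 <= x -> clamp x = 1.
Proof. by move=> x1; rewrite /clamp min_l // max_r. Qed.

Lemma clamp_id x : 0 <= x <= 1 -> clamp x = x.
Proof. by move=> /andP[x0 x1]; rewrite /clamp min_r // max_r. Qed.

Lemma polylineE (c : nat -> W) k i (x : R) : (i < k)%N -> 0 <= x <= 1 ->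
  polyline c k ((i%:R + x) / k%:R) = c i + x *: (c i.+1 - c i).
Proof.
move=> ik x01; have kn0 : k%:R != 0 :> R by rewrite pnatr_eq0; lia.
have /andP[x0 x1] := x01.
rewrite /polyline mulrC divfK // (@big_cat_nat _ _ _ i) //=; last exact: ltnW.
rewrite (big_ltn ik) addrA [i%:R + x]addrC addrK clamp_id // addrA.
rewrite [X in _ + X]big_nat_cond [X in _ + X]big1 ?addr0; last first.
  move=> j /andP[/andP[ij jk] _]; rewrite clamp_le0 ?scale0r //.
  by rewrite subr_le0 -lerBrDr -natrB ?(ltnW ij) // (le_trans x1) // ler1n subn_gt0.
rewrite addrA; congr (_ + _); rewrite (eq_big_nat _ _ (F2 := fun j => c j.+1 - c j)).
  by rewrite telescope_sumr // addrC subrK.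
move=> j /andP[_ ji]; rewrite clamp_ge1 ?scale1r //.
by rewrite -addrA -natrB ?(ltnW ji) // -[leLHS]add0r lerD // ler1n subn_gt0.
Qed.

Lemma clamp_continuous : continuous clamp.
Proof.
move=> x; apply: (@continuous_max R R (cst 0) (fun x => Num.min 1 x)).
  exact: cvg_cst.
by apply: (@continuous_min R R (cst 1) id); [exact: cvg_cst | exact: cvg_id].
Qed.

Lemma polyline_continuous c k : continuous (polyline c k).
Proof.
move=> s; apply: cvgD; first exact: cvg_cst.
apply: (@cvg_sum R W _ _ _ _ (nbhs s)
  (fun i s => clamp (k%:R * s - i%:R) *: (c i.+1 - c i))) => i _.
apply: cvgZ; last exact: cvg_cst.
apply: (@continuous_comp R R R (fun s : R => k%:R * s - i%:R) clamp s).
  apply: cvgB; last exact: cvg_cst.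
  by apply: cvgM; [exact: cvg_cst | exact: cvg_id].
exact: clamp_continuous.
Qed.

(** At s = 1 the last step is used with offset 1, because the truncation of
    k s would be k. *)
Lemma unit_subdivision k (s : R) : (0 < k)%N -> 0 <= s <= 1 ->
  exists i x, [/\ (i < k)%N, 0 <= x <= 1 & s = (i%:R + x) / k%:R].
Proof.
move=> k0 /andP[s0 s1]; have kn0 : k%:R != 0 :> R by rewrite pnatr_eq0; lia.
have kp : 0 < k%:R :> R by rewrite ltr0n.
have [->|sn1] := eqVneq s 1.
  exists k.-1, 1; rewrite prednK // leqnn ler01 lexx; split => //.
  by rewrite natr1 prednK // divff.
exists (Num.truncn (k%:R * s)), (k%:R * s - (Num.truncn (k%:R * s))%:R).
have /andP[t1 t2] :
    (Num.truncn (k%:R * s))%:R <= k%:R * s < (Num.truncn (k%:R * s)).+1%:R.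
  by apply: truncn_itv; rewrite mulr_ge0 // ler0n.
split.
- rewrite -(ltr_nat R) (le_lt_trans t1) // gtr_pMr // lt_neqAle sn1 //.
- by rewrite subr_ge0 t1 /= lerBlDr nat1r ltW.
- by rewrite addrC subrK mulrAC divff // mul1r.
Qed.

End Polyline.

(** * Subdivisions of a square *)

Section UnitSquare.
Set Implicit Arguments.
Unset Strict Implicit.
Context {R : realType} {V : normedModType R}.

Definition unit_square : set (R * R) := `[0, 1]%classic `*` `[0, 1]%classic.

(** Every point of the square has a neighbourhood sent into a ball contained in
    D; the covering form of compactness, taken along the filter of large N,
    makes the size of these neighbourhoods uniform. *)
Lemma lebesgue_number (D : set V) (H : R * R -> V) :
  open D -> {within unit_square, continuous H} ->
  (forall z, unit_square z -> D (H z)) ->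
  exists N0, forall N, (N0 <= N)%N -> forall x, unit_square x ->
    exists c, exists r : R, ball c r `<=` D /\
      forall y, unit_square y -> `|y - x| <= N.+1%:R^-1 -> ball c r (H y).
Proof.
move=> oD cH HD.
have cK : compact unit_square by apply: compact_setX; exact: segment_compact.
pose P N (x : R * R) := exists c, exists r : R, ball c r `<=` D /\
  forall y, unit_square y -> `|y - x| <= N.+1%:R^-1 -> ball c r (H y).
suff : \forall N \near \oo, unit_square `<=` P N.
  by move=> [N0 _ HN]; exists N0 => N NN x; exact: HN.
have /compact_near_coveringP K_cover := cK.
apply: K_cover => x Kx.
have [r r0 rD] : exists2 r : R, 0 < r & ball (H x) r `<=` D.
  have /nbhs_ballP [r /= r0 rD] := open_nbhs_nbhs (conj oD (HD x Kx)).
  by exists r.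
have near_x : \forall y \near x, unit_square y -> ball (H x) r (H y).
  move/subspace_continuousP : cH => /(_ x Kx) cHx.
  by have := cHx _ (nbhsx_ballx (H x) r r0).
have /nbhs_normP [d /= d0 dH] := near_x.
have d2 : 0 < d / 2 by rewrite divr_gt0.
near=> y N => /=.
exists (H x), r; split => // z Kz zy; apply: dH => //=.
rewrite /ball_ /= (_ : x - z = (x - y) + (y - z)); last by rewrite addrA subrK.
rewrite (le_lt_trans (ler_normD _ _)) // [ltRHS](splitr d) ltrD //.
rewrite distrC (le_lt_trans zy) //.
near: N; exact: near_infty_natSinv_lt (PosNum d2).
Unshelve. all: by end_near. Qed.

End UnitSquare.

(** * Closed one-forms on simply connected domains *)

Section Monodromy.
Set Implicit Arguments.
Unset Strict Implicit.
Context {R : realType} {m : nat}.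
Notation V := 'cV[R]_m.
Variables (D : set V) (w : 'I_m -> V -> R).
Hypothesis w_C1 : forall j, C1_on D (w j).
Hypothesis w_closed : forall i j t, D t ->
  'D_(unitv i) (w j) t = 'D_(unitv j) (w i) t.

Lemma ball_primitive c r : ball c r `<=` D -> exists g, primitive (ball c r) w g.
Proof.
move=> cD; exists (radial_integral c w); apply: local_primitive => [j|i j] t ct.
  by apply: w_C1; exact: cD.
by apply: w_closed; exact: cD.
Qed.

Lemma ball_segment (c : V) (r : R) (p q : V) (k : R) : ball c r p -> ball c r q ->
  0 <= k <= 1 -> ball c r (p + k *: (q - p)).
Proof.
rewrite -ball_normE /ball_ /= => cp cq /andP[k0 k1].
have -> : c - (p + k *: (q - p)) = (1 - k) *: (c - p) + k *: (c - q).
  by apply/matrixP => i j; rewrite !mxE; ring.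
rewrite (le_lt_trans (ler_normD _ _)) // !normrZ !ger0_norm ?subr_ge0 //.
have [->|kn0] := eqVneq k 0; first by rewrite subr0 mul1r mul0r addr0.
have -> : r = (1 - k) * r + k * r by ring.
apply: ler_ltD; first by rewrite ler_wpM2l ?subr_ge0 // ltW.
by rewrite ltr_pM2l // lt0r kn0.
Qed.

(** The intersection of two balls is convex, so the difference of the two
    primitives is constant along the segment from p to q. *)
Lemma primitive_increment c1 r1 g1 c2 r2 g2 p q :
  primitive (ball c1 r1) w g1 -> primitive (ball c2 r2) w g2 ->
  ball c1 r1 p -> ball c1 r1 q -> ball c2 r2 p -> ball c2 r2 q ->
  g1 q - g1 p = g2 q - g2 p.
Proof.
move=> P1 P2 p1 q1 p2 q2.
have dh (k : R) : 0 <= k <= 1 ->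
    is_derive k 1 (fun k : R => g1 (p + k *: (q - p)) - g2 (p + k *: (q - p))) 0.
  move=> k01.
  have [d1 D1] := P1 _ (ball_segment p1 q1 k01).
  have [d2 D2] := P2 _ (ball_segment p2 q2 k01).
  have := is_deriveB (is_derive_diff_line _ _ _ _ _ _ d1)
     (is_derive_diff_line _ _ _ _ _ _ d2).
  by rewrite D1 D2 subrr.
have [k|| k k01] := @MVT_segment R
    (fun k : R => g1 (p + k *: (q - p)) - g2 (p + k *: (q - p)))
    (cst 0) 0 1 ler01.
- by rewrite in_itv /= => /andP[k0 k1]; apply: dh; rewrite !ltW.
- apply: derivable_within_continuous => k; rewrite in_itv /= => k01.
  by have [] := dh k k01.
rewrite scale0r addr0 scale1r [p + _]addrC subrK /cst mul0r => h.
by apply/eqP; rewrite -subr_eq0; apply/eqP; rewrite -[RHS]h; ring.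
Qed.

(** The pairs of points between which the form has a well-defined increment. *)
Definition near_in p q := exists c r, [/\ ball c r `<=` D, ball c r p & ball c r q].

(** The increment g q - g p of any primitive g on any ball contained in D that
    holds p and q; by [stepE] it depends neither on the ball nor on g. *)
Definition step p q : R := get (fun e : R => exists c r g,
  [/\ ball c r `<=` D, primitive (ball c r) w g, ball c r p, ball c r q &
      e = g q - g p]).

Lemma stepE c r g p q : ball c r `<=` D -> primitive (ball c r) w g ->
  ball c r p -> ball c r q -> step p q = g q - g p.
Proof.
move=> cD Pg cp cq; rewrite /step.
set P := (X in get X); have : exists e, P e by exists (g q - g p), c, r, g.
move=> /getPex [c' [r' [g' [_ Pg' cp' cq' ->]]]].
exact: (primitive_increment Pg' Pg).
Qed.

Lemma step_add c r p q s : ball c r `<=` D -> ball c r p -> ball c r q ->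
  ball c r s -> step p q + step q s = step p s.
Proof.
move=> cD cp cq cs; have [g Pg] := ball_primitive cD.
rewrite !(stepE cD Pg) //; ring.
Qed.

Lemma step_refl p q : near_in p q -> step p p = 0.
Proof.
move=> [c [r [cD cp _]]]; have [g Pg] := ball_primitive cD.
by rewrite (stepE cD Pg) // subrr.
Qed.

Lemma near_in_sym p q : near_in p q -> near_in q p.
Proof. by move=> [c [r [cD cp cq]]]; exists c, r. Qed.

Lemma step_sym p q : near_in p q -> step q p = - step p q.
Proof.
move=> [c [r [cD cp cq]]]; have [g Pg] := ball_primitive cD.
by rewrite !(stepE cD Pg) // opprB.
Qed.

(** [reach p q a]: some chain from p to q has the sum a of increments.  An
    inductive predicate makes concatenation and reversal of chains simple
    inductions; [reach_chain] recovers the points of the chain. *)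
Inductive reach (p : V) : V -> R -> Prop :=
| reach0 : reach p p 0
| reachS q q' a : reach p q a -> near_in q q' -> reach p q' (a + step q q').

Lemma reach_trans p q s a b : reach p q a -> reach q s b -> reach p s (a + b).
Proof.
move=> pq; elim=> [|s1 s2 c _ IH s12]; first by rewrite addr0.
by rewrite addrA; apply: reachS.
Qed.

Lemma reach_sym p q a : reach p q a -> reach q p (- a).
Proof.
elim=> [|s1 s2 c _ IH s12]; first by rewrite oppr0; exact: reach0.
rewrite opprD addrC -step_sym //; apply: reach_trans IH.
by rewrite -[step _ _]add0r; apply: reachS (near_in_sym s12); exact: reach0.
Qed.

Definition chain_sum (c : nat -> V) k := \sum_(0 <= i < k) step (c i) (c i.+1).

Lemma reach_chain p q a : reach p q a -> exists k c,
  [/\ c 0%N = p, c k = q, forall i, (i < k)%N -> near_in (c i) (c i.+1) &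
      a = chain_sum c k].
Proof.
elim=> [|s1 s2 b _ [k [c [c0 ck cn ->]]] s12].
  by exists 0%N, (fun=> p); split => //; rewrite /chain_sum big_geq.
exists k.+1, (fun i => if (i <= k)%N then c i else s2); split => //.
- by rewrite ltnn.
- move=> i; rewrite ltnS leq_eqVlt => /orP[/eqP ->|ik].
    by rewrite eqxx ltnn ck.
  by rewrite ik orbT; exact: cn.
- rewrite /chain_sum big_nat_recr //= leqnn ltnn ck; congr (_ + _).
  by apply: eq_big_nat => i /andP[_ ik]; rewrite (ltnW ik) ik.
Qed.

(** The four increments around a cell cancel, so two consecutive rows differ by
    the increments along the left and right sides, which are zero because these
    sides are constant. *)
Lemma grid_row_sum N (e : nat -> nat -> V) b :
  (forall i j, (i < N)%N -> (j < N)%N -> exists c r, [/\ ball c r `<=` D,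
     ball c r (e i j), ball c r (e i j.+1), ball c r (e i.+1 j) &
     ball c r (e i.+1 j.+1)]) ->
  (forall i, (i <= N)%N -> e i 0%N = b /\ e i N = b) ->
  (forall j, (j <= N)%N -> e N j = b) ->
  \sum_(0 <= j < N) step (e 0%N j) (e 0%N j.+1) = 0.
Proof.
have [->|N0] := posnP N; first by rewrite big_geq.
move=> cell sides top; pose S i := \sum_(0 <= j < N) step (e i j) (e i j.+1).
have bb : step b b = 0.
  have [c [r [cD cb _ _ _]]] := cell 0%N 0%N N0 N0.
  by rewrite -(sides 0%N (leq0n _)).1 (@step_refl _ (e 0%N 0%N)) //; exists c, r.
have rows i : (i < N)%N -> S i = S i.+1.
  move=> iN; apply/eqP; rewrite -subr_eq0 -sumrB; apply/eqP.
  pose v j := step (e i j) (e i.+1 j).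
  rewrite (eq_big_nat _ _ (F2 := fun j => - v j.+1 - - v j)).
    rewrite telescope_sumr // /v; have [-> ->] := sides i (ltnW iN).
    by have [-> ->] := sides i.+1 iN; rewrite bb subrr.
  move=> j /andP[_ jN]; have [c [r [cD c00 c01 c10 c11]]] := cell i j iN jN.
  have h1 := step_add cD c00 c01 c11; have h2 := step_add cD c00 c10 c11.
  by rewrite /v; lra.
have -> : \sum_(0 <= j < N) step (e 0%N j) (e 0%N j.+1) = S N.
  have : forall i, (i <= N)%N -> S 0%N = S i.
    elim=> [_|i IH iN]; first by [].
    by rewrite -(rows i iN); apply: IH; exact: ltnW.
  exact.
rewrite /S big_nat_cond big1 // => j /andP[/andP[_ jN] _].
by rewrite !top // ltnW.
Qed.

Lemma sum_blocks (F : nat -> R) k M :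
  \sum_(0 <= j < k * M) F j =
  \sum_(0 <= i < k) \sum_(0 <= l < M) F (i * M + l)%N.
Proof.
elim: k => [|k IH]; first by rewrite !big_geq.
rewrite big_nat_recr //= -IH (@big_cat_nat _ _ _ (k * M)) //=; last first.
  by rewrite leq_mul2r leqnSn orbT.
congr (_ + _); rewrite -{1}[(k * M)%N]add0n big_addn mulSn addnK.
by apply: eq_bigr => i _; rewrite addnC.
Qed.

Hypothesis D_sc : simply_connected_domain (R := R) D.

(** The grid has N = k (N0 + 1) columns: a multiple of k, so that the vertices
    of the polygon are grid points and each edge of the chain is cut into N0 + 1
    steps inside one ball, and large enough for the bound N0 given by
    [lebesgue_number]. *)
Lemma loop_chain_sum0 c k :
  (forall i, (i < k)%N -> near_in (c i) (c i.+1)) -> c 0%N = c k ->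
  chain_sum c k = 0.
Proof.
have [[D0 oD _] D_contract] := D_sc.
have [->|k0] := posnP k; first by rewrite /chain_sum big_geq.
have kn0 : k%:R != 0 :> R by rewrite pnatr_eq0; lia.
move=> cn c0k; pose g := polyline c k.
have gE i (x : R) : (i < k)%N -> 0 <= x <= 1 ->
    g ((i%:R + x) / k%:R) = c i + x *: (c i.+1 - c i) by exact: polylineE.
have gD s : s \in `[0, 1] -> D (g s).
  rewrite in_itv /= => s01; have [i [x [ik x01 ->]]] := unit_subdivision k0 s01.
  rewrite gE //; have [b [r [bD bi bi1]]] := cn i ik.
  by apply: bD; exact: ball_segment.
have g0 : g 0 = c 0%N.
  have := @gE 0%N 0 k0; rewrite lexx ler01 addr0 mul0r scale0r addr0; exact.
have g1 : g 1 = c k.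
  have := @gE k.-1 1; rewrite prednK // leqnn natr1 prednK // divff // => ->//.
    by rewrite scale1r addrC subrK.
  by rewrite ler01 lexx.
have gloop : g 0 = g 1 by rewrite g0 g1.
have cg : {within `[0, 1], continuous g}.
  by apply: continuous_subspaceT; exact: polyline_continuous.
have [H [cH HD H0 H1 Hs]] := D_contract g cg gD gloop.
have [z|N0 HN] := lebesgue_number oD cH.
  by case: z => u s [] /= us ss; exact: HD.
pose N := (k * N0.+1)%N.
have N_gt0 : (0 < N)%N by rewrite muln_gt0 k0.
have Nn0 : N%:R != 0 :> R by rewrite pnatr_eq0; lia.
pose q i : R := i%:R / N%:R.
have q01 i : (i <= N)%N -> 0 <= q i <= 1.
  move=> iN; rewrite divr_ge0 ?ler0n // ler_pdivrMr ?ltr0n // mul1r ler_nat //.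
have qS i : q i.+1 - q i = N%:R^-1.
  by rewrite /q -mulrBl -natrB ?leqnSn // subSnn mul1r.
have q0 : q 0%N = 0 by rewrite /q mul0r.
have qN : q N = 1 by rewrite /q divff.
(* The first row of the grid is the loop itself, the sum along which is cut
   below into the edges of the chain. *)
have row0 : \sum_(0 <= j < N) step (g (q j)) (g (q j.+1)) = 0.
  have qI i : (i <= N)%N -> q i \in `[0, 1] by rewrite in_itv /=; exact: q01.
  transitivity (\sum_(0 <= j < N) step (H (q 0%N, q j)) (H (q 0%N, q j.+1))).
    apply: eq_big_nat => j /andP[_ jN]; rewrite q0 !H0 //; apply: qI => //.
    exact: ltnW.
  apply: (@grid_row_sum N (fun i j => H (q i, q j)) (g 0)) => [i j iN jN|i iN|j jN].
  - have NE : N.-1.+1 = N by rewrite prednK.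
    have NN0 : (N0 <= N.-1)%N.
      by rewrite -ltnS NE /N (leq_trans (ltnSn N0)) // leq_pmull.
    have sq a b : (a <= N)%N -> (b <= N)%N -> unit_square (q a, q b).
      by move=> aN bN; split=> /=; [exact: qI | exact: qI].
    have [b [r [bD Hb]]] := HN _ NN0 _ (sq i j (ltnW iN) (ltnW jN)).
    exists b, r; rewrite NE in Hb.
    have close i' j' : (i' <= N)%N -> (j' <= N)%N ->
        (i' == i) || (i' == i.+1) -> (j' == j) || (j' == j.+1) ->
        ball b r (H (q i', q j')).
      move=> iN' jN' ii jj; apply: Hb; first exact: sq.
      have d k1 k2 : (k1 == k2) || (k1 == k2.+1) -> `|q k1 - q k2| <= N%:R^-1.
        case/orP => /eqP ->; first by rewrite subrr normr0 invr_ge0 ler0n.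
        by rewrite qS ger0_norm // invr_ge0 ler0n.
      by rewrite [`|_|]prod_normE /= ge_max !d.
    have [iN' jN'] := (ltnW iN, ltnW jN).
    by split => //; apply: close; rewrite ?eqxx ?orbT.
  - by rewrite q0 qN; exact: Hs (qI i iN).
  - by rewrite qN H1 //; exact: qI.
rewrite -{}row0 /N sum_blocks; apply: eq_big_nat => i /andP[_ ik].
have [b [r [bD bi bi1]]] := cn i ik; have [p Pp] := ball_primitive bD.
pose pt l := c i + (l%:R / N0.+1%:R) *: (c i.+1 - c i).
have M01 l : (l <= N0.+1)%N -> 0 <= (l%:R / N0.+1%:R : R) <= 1.
  move=> lM; rewrite divr_ge0 ?ler0n // ler_pdivrMr ?ltr0n // mul1r ler_nat //.
have ptE l : (l <= N0.+1)%N -> g (q (i * N0.+1 + l)%N) = pt l.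
  move=> lM; rewrite /pt -gE ?M01 //; congr g; rewrite /q /N natrD !natrM.
  have : N0.+1%:R != 0 :> R by rewrite pnatr_eq0.
  by move: (N0.+1%:R : R) => M Mn0; field; rewrite kn0.
rewrite (eq_big_nat _ _ (F2 := fun l => p (pt l.+1) - p (pt l))).
  rewrite telescope_sumr // /pt mul0r scale0r addr0 divff ?pnatr_eq0 // scale1r.
  by rewrite [c i + _]addrC subrK (stepE bD Pp).
move=> l /andP[_ lM]; rewrite -addnS !ptE //; last exact: ltnW.
by apply: (stepE bD Pp); apply: ball_segment => //; apply: M01 => //; exact: ltnW.
Qed.

Lemma reach_unique p q a b : reach p q a -> reach p q b -> a = b.
Proof.
move=> pa pb; have := reach_trans pa (reach_sym pb).
move=> /reach_chain [k [c [c0 ck cn ab]]]; apply/eqP; rewrite -subr_eq0 ab.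
by rewrite loop_chain_sum0 // c0 ck.
Qed.

(** The set of reachable points is open and closed in the connected set D,
    because two points of a ball contained in D are reachable together. *)
Lemma reach_total p : D p -> forall q, D q -> exists a, reach p q a.
Proof.
move=> Dp; have [[_ oD cD] _] := D_sc.
pose A := [set q | D q /\ exists a, reach p q a].
have ballD q : D q -> exists2 r : R, 0 < r & ball q r `<=` D.
  move=> Dq; have /nbhs_ballP [r /= r0 rD] := open_nbhs_nbhs (conj oD Dq).
  by exists r.
have nbA q : D q -> exists2 r : R, 0 < r &
    forall q', ball q r q' -> (A q' <-> A q).
  move=> Dq; have [r r0 rD] := ballD q Dq; exists r => // q' qq'.
  have nq : near_in q q' by exists q, r; split => //; exact: ballxx.
  split=> -[_ [a pa]]; split; do ?[exact: rD | exact: Dq].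
    by exists (a + step q' q); apply: reachS pa _; exact: near_in_sym.
  by exists (a + step q q'); apply: reachS pa _.
suff AD : A = D by move=> q; rewrite -AD => -[].
have oA : open A.
  rewrite openE => q Aq; have [r r0 Ar] := nbA q Aq.1.
  by apply/nbhs_ballP; exists r => //= q' /Ar ->.
apply: cD.
- by exists p; split=> //; exists 0; exact: reach0.
- by exists A => //; apply/seteqP; split=> [q Aq|q []] //; split=> //; exact: Aq.1.
(* The unreachable points of D form an open set, whose complement is closed. *)
exists (~` (D `\` A)); last first.
  apply/seteqP; split=> [q Aq|q [Dq nA]].
    by split; [exact: Aq.1 | case].
  by apply: contrapT => nAq; apply: nA.
apply: open_closedC; rewrite openE => q [Dq nAq].
have [r r0 Ar] := nbA q Dq; have [r' r'0 rD] := ballD q Dq.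
apply/nbhs_ballP; exists (Num.min r r'); first by rewrite /= lt_min r0.
move=> q' qq'; split.
  by apply: rD; apply: le_ball qq'; rewrite ge_min lexx orbT.
have qq'' : ball q r q' by apply: le_ball qq'; rewrite ge_min lexx.
by move=> Aq'; apply: nAq; exact: (Ar q' qq'').1 Aq'.
Qed.

(** Near each point the sum of increments along chains differs from a local
    primitive by a constant. *)
Lemma poincare : exists g, primitive D w g.
Proof.
have [[[p Dp] oD _] _] := D_sc.
pose g q := get [set a | reach p q a].
have gE q : D q -> reach p q (g q).
  by move=> Dq; have [a pa] := reach_total Dp Dq; apply: (@getI _ _ a).
exists g => q Dq.
have /nbhs_ballP [r /= r0 rD] := open_nbhs_nbhs (conj oD Dq).
have [h Ph] := ball_primitive rD.
have gh : {near q, (fun q' => h q' + (g q - h q)) =1 g}.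
  apply/nbhs_ballP; exists r => //= q' qq'.
  have qq : ball q r q by exact: ballxx.
  have nq : near_in q q' by exists q, r.
  rewrite (reach_unique (gE q' (rD q' qq')) (reachS (gE q Dq) nq)).
  by rewrite (stepE rD Ph) //; ring.
have [dh Dh] := Ph q (ballxx _ r0).
have dhc : differentiable (fun q' => h q' + (g q - h q)) q.
  by apply: differentiableD.
split; first exact: near_differentiable gh dhc.
move=> u; rewrite -(near_eq_derive u gh) -Dh.
rewrite (@deriveD _ _ _ h (cst (g q - h q))) ?derive_cst ?addr0 //.
exact: diff_derivable.
Qed.

End Monodromy.

(** * Real functions of class C1 *)

Section C1Functions.
Set Implicit Arguments.
Unset Strict Implicit.
Context {R : realType}.

(** Derivatives are computed on an open set only; their continuity at a point is
    transferred along equality near this point. *)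
Lemma near_continuous (V W : normedModType R) (f g : V -> W) (x : V) :
  {near x, f =1 g} -> {for x, continuous f} -> {for x, continuous g}.
Proof.
move=> fg cf; rewrite /prop_for /continuous_at -(nbhs_singleton fg).
by apply: cvg_trans cf; exact: near_eq_cvg.
Qed.

Lemma open_near (V : normedModType R) (D : set V) (P : V -> Prop) (x : V) :
  open D -> D x -> (forall y, D y -> P y) -> \forall y \near x, P y.
Proof.
by move=> oD Dx DP; apply: filterS DP _; apply: open_nbhs_nbhs.
Qed.

Section OnOpen.
Variables (V : normedModType R) (D : set V).
Hypothesis oD : open D.
Implicit Types f g : V -> R.

(** It is enough to know the directional derivatives on the open set, where the
    given formula agrees with them near every point. *)
Lemma C1_of_derive f (df : V -> V -> R) :
  (forall p, D p -> differentiable f p) ->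
  (forall u p, D p -> 'D_u f p = df u p) ->
  (forall u p, D p -> {for p, continuous (df u)}) -> C1_on D f.
Proof.
move=> dif Df cf p Dp; split=> [|u]; first exact: dif.
apply: near_continuous (cf u p Dp); apply: open_near oD Dp _ => q Dq.
by rewrite Df.
Qed.

Lemma C1_continuous f p : C1_on D f -> D p -> {for p, continuous f}.
Proof. by move=> Cf /Cf [df _]; exact: differentiable_continuous. Qed.

Lemma eq_C1 f g : (forall p, D p -> f p = g p) -> C1_on D f -> C1_on D g.
Proof.
move=> fg Cf; have fgn p : D p -> {near p, f =1 g}.
  by move=> Dp; apply: open_near oD Dp _ => q /fg.
apply: (@C1_of_derive _ (fun u p => 'D_u f p)).
- by move=> p Dp; apply: near_differentiable (fgn p Dp) _; have [] := Cf p Dp.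
- by move=> u p Dp; rewrite (near_eq_derive u (fgn p Dp)).
- by move=> u p Dp; have [_ ] := Cf p Dp.
Qed.

Lemma C1_cst (a : R) : C1_on D (cst a).
Proof.
apply: (@C1_of_derive _ (fun _ _ => 0)) => // u p _; first by rewrite derive_cst.
exact: cvg_cst.
Qed.

Lemma C1_add f g : C1_on D f -> C1_on D g -> C1_on D (fun p => f p + g p).
Proof.
move=> Cf Cg; apply: (@C1_of_derive _ (fun u p => 'D_u f p + 'D_u g p)).
- by move=> p Dp; apply: differentiableD; [have [] := Cf p Dp | have [] := Cg p Dp].
- move=> u p Dp; have [df _] := Cf p Dp; have [dg _] := Cg p Dp.
  by apply: deriveD; exact: diff_derivable.
- move=> u p Dp; have [_ /(_ u) df] := Cf p Dp; have [_ /(_ u) dg] := Cg p Dp.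
  by apply: cvgD; [exact: df | exact: dg].
Qed.

Lemma C1_mul f g : C1_on D f -> C1_on D g -> C1_on D (fun p => f p * g p).
Proof.
move=> Cf Cg; apply: (@C1_of_derive _ (fun u p => f p * 'D_u g p + g p * 'D_u f p)).
- by move=> p Dp; apply: differentiableM; [have [] := Cf p Dp | have [] := Cg p Dp].
- move=> u p Dp; have [df _] := Cf p Dp; have [dg _] := Cg p Dp.
  by apply: deriveM; exact: diff_derivable.
- move=> u p Dp; have [_ /(_ u) df] := Cf p Dp; have [_ /(_ u) dg] := Cg p Dp.
  apply: cvgD; apply: cvgM; do ?[exact: df | exact: dg | exact: C1_continuous].
Qed.

Lemma derive_comp1 (h : R -> R) f p (d : R) :
  differentiable f p -> is_derive (f p) 1 h d ->
  differentiable (h \o f) p /\ (forall u, 'D_u (h \o f) p = d * 'D_u f p).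
Proof.
move=> df [dh Dh].
have dhp : differentiable h (f p) by apply/derivable1_diffP.
split=> [|u]; first exact: differentiable_comp.
rewrite deriveE; last exact: differentiable_comp.
by rewrite diff_comp //= diff1E // derive1E Dh -deriveE // mulrC.
Qed.

Lemma C1_comp1 (h h' : R -> R) f :
  (forall p, D p -> is_derive (f p) 1 h (h' (f p))) ->
  (forall p, D p -> {for f p, continuous h'}) ->
  C1_on D f -> C1_on D (h \o f).
Proof.
move=> dh ch Cf.
have dhf p (Dp : D p) := derive_comp1 (Cf p Dp).1 (dh p Dp).
apply: (@C1_of_derive _ (fun u p => h' (f p) * 'D_u f p)).
- by move=> p Dp; have [] := dhf p Dp.
- by move=> u p Dp; have [_ ->] := dhf p Dp.
- move=> u p Dp; have [df /(_ u) cf] := Cf p Dp; apply: cvgM; last exact: cf.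
  by apply: continuous_comp; [exact: C1_continuous | exact: ch].
Qed.

Lemma C1_inv f : (forall p, D p -> f p != 0) -> C1_on D f ->
  C1_on D (fun p => (f p)^-1).
Proof.
move=> f0 Cf.
have dV (x : R) : x != 0 -> is_derive x 1 (fun y : R => y^-1) (- x ^- 2).
  move=> x0; have dx : derivable (fun y : R => y^-1) x 1.
    by apply/derivable1_diffP; exact: differentiable_Rinv.
  apply: DeriveDef => //; rewrite deriveE; last exact: differentiable_Rinv.
  by rewrite diff_Rinv // [LHS]mulr1.
have cV (x : R) : x != 0 -> {for x, continuous (fun x : R => - x ^- 2)}.
  move=> x0; apply: cvgN; apply: cvgV; first by rewrite expf_neq0.
  exact: exprn_continuous.
apply: (@C1_comp1 (fun y : R => y^-1) (fun x => - x ^- 2) f _ _ Cf).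
  by move=> p Dp; apply: dV; exact: f0.
by move=> p Dp; apply: cV; exact: f0.
Qed.

End OnOpen.

Lemma C1_comp_linear (U V : normedModType R) (L : {linear U -> V}) (D : set V)
    (g : V -> R) : open D -> continuous L -> C1_on D g ->
  C1_on (L @^-1` D) (g \o L) /\
  (forall u p, D (L p) -> 'D_u (g \o L) p = 'D_(L u) g (L p)).
Proof.
move=> oD cL Cg; have dL p : differentiable L p by exact: linear_differentiable.
have Dg u p : differentiable g (L p) -> 'D_u (g \o L) p = 'D_(L u) g (L p).
  move=> dg; rewrite !deriveE //; last exact: differentiable_comp.
  by rewrite diff_comp //= diff_lin.
split; last by move=> u p Dp; apply: Dg; have [] := Cg _ Dp.
have oLD : open (L @^-1` D) by apply: open_comp => // p _; exact: cL.
apply: (@C1_of_derive _ _ oLD _ (fun u p => 'D_(L u) g (L p))).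
- by move=> p Dp; apply: differentiable_comp => //; have [] := Cg _ Dp.
- by move=> u p Dp; apply: Dg; have [] := Cg _ Dp.
- move=> u p Dp; have [_ /(_ (L u)) cg] := Cg _ Dp.
  by apply: (@continuous_comp _ _ _ L (fun q => 'D_(L u) g q)); [exact: cL | exact: cg].
Qed.

Lemma C1_linear (V : normedModType R) (D : set V) (L : {linear V -> R}) :
  open D -> continuous L -> C1_on D L /\ (forall u p, 'D_u L p = L u).
Proof.
move=> oD cL; have dL p : differentiable L p by exact: linear_differentiable.
have DL u p : 'D_u L p = L u by rewrite deriveE // diff_lin.
split; last exact: DL.
apply: (@C1_of_derive V D oD L (fun u _ => L u)) => [p _|u p _|u p _].
- exact: dL.
- exact: DL.
- exact: cvg_cst.
Qed.

End C1Functions.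

(** * Differentials of complex-valued functions *)

Section ComplexCalculus.
Set Implicit Arguments.
Unset Strict Implicit.
Context {R : realType}.
Notation C := R[i].

Lemma complexE (z : C) : z = complex.Re z +i* complex.Im z.
Proof. by case: z. Qed.
Lemma Re_add (z t : C) : complex.Re (z + t) = complex.Re z + complex.Re t.
Proof. by case: z => a b; case: t. Qed.
Lemma Im_add (z t : C) : complex.Im (z + t) = complex.Im z + complex.Im t.
Proof. by case: z => a b; case: t. Qed.
Lemma Re_mul (z t : C) : complex.Re (z * t) =
  complex.Re z * complex.Re t + - 1 * (complex.Im z * complex.Im t).
Proof. by case: z => a b; case: t => c d /=; rewrite mulN1r. Qed.
Lemma Im_mul (z t : C) : complex.Im (z * t) =
  complex.Re z * complex.Im t + complex.Im z * complex.Re t.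
Proof. by case: z => a b; case: t. Qed.
Lemma Re_inv (z : C) : complex.Re z^-1 =
  complex.Re z * (complex.Re z * complex.Re z + complex.Im z * complex.Im z)^-1.
Proof. by case: z => a b /=; rewrite -!expr2. Qed.
Lemma Im_inv (z : C) : complex.Im z^-1 =
  - 1 * (complex.Im z *
    (complex.Re z * complex.Re z + complex.Im z * complex.Im z)^-1).
Proof. by case: z => a b /=; rewrite -!expr2 mulN1r. Qed.

Lemma sqr_norm_neq0 (z : C) : z != 0 ->
  complex.Re z * complex.Re z + complex.Im z * complex.Im z != 0.
Proof.
case: z => a b; apply: contraNneq => /= /eqP.
by rewrite -!expr2 paddr_eq0 ?sqr_ge0 // !sqrf_eq0 => /andP[/eqP -> /eqP ->].
Qed.

Section OnOpen.
Variables (V : normedModType R) (D : set V).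
Hypothesis oD : open D.
Implicit Types f g : V -> C.

Lemma eq_cC1 f g : (forall p, D p -> f p = g p) -> cC1_on D f -> cC1_on D g.
Proof.
by move=> fg [Cr Ci]; split; [apply: eq_C1 Cr | apply: eq_C1 Ci] => // p Dp;
  rewrite /re_fun /im_fun fg.
Qed.

Lemma cC1_cdifferentiable g p : cC1_on D g -> D p -> cdifferentiable g p.
Proof. by move=> [Cr Ci] Dp; split; [have [] := Cr p Dp | have [] := Ci p Dp]. Qed.

Lemma cC1_cst (a : C) : cC1_on D (cst a).
Proof. by split; exact: C1_cst. Qed.

Lemma cC1_add f g : cC1_on D f -> cC1_on D g -> cC1_on D (fun p => f p + g p).
Proof.
move=> [fr fi] [gr gi]; split; [apply: eq_C1 (C1_add oD fr gr) |
  apply: eq_C1 (C1_add oD fi gi)] => // p _; rewrite /re_fun /im_fun.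
  by rewrite Re_add.
by rewrite Im_add.
Qed.

Lemma cC1_mul f g : cC1_on D f -> cC1_on D g -> cC1_on D (fun p => f p * g p).
Proof.
move=> [fr fi] [gr gi]; split.
  apply: eq_C1 (C1_add oD (C1_mul oD fr gr)
    (C1_mul oD (C1_cst oD (-1)) (C1_mul oD fi gi))) => // p _.
  by rewrite /re_fun Re_mul.
apply: eq_C1 (C1_add oD (C1_mul oD fr gi) (C1_mul oD fi gr)) => // p _.
by rewrite /im_fun Im_mul.
Qed.

Lemma cC1_opp f : cC1_on D f -> cC1_on D (fun p => - f p).
Proof.
move=> Cf; apply: eq_cC1 (cC1_mul (cC1_cst (-1)) Cf) => p _.
by rewrite /cst mulN1r.
Qed.

Lemma cC1_sum (I : Type) (r : seq I) (P : pred I) (f : I -> V -> C) :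
  (forall i, P i -> cC1_on D (f i)) ->
  cC1_on D (fun p => \sum_(i <- r | P i) f i p).
Proof.
move=> Cf; elim: r => [|i r IH].
  by apply: eq_cC1 (cC1_cst 0) => p _; rewrite big_nil.
have [Pi|nPi] := boolP (P i); last first.
  by apply: eq_cC1 IH => p _; rewrite big_cons (negbTE nPi).
by apply: eq_cC1 (cC1_add (Cf i Pi) IH) => p _; rewrite big_cons Pi.
Qed.

Lemma cC1_inv f : (forall p, D p -> f p != 0) -> cC1_on D f ->
  cC1_on D (fun p => (f p)^-1).
Proof.
move=> f0 [fr fi].
have n2 := C1_add oD (C1_mul oD fr fr) (C1_mul oD fi fi).
have iv := @C1_inv R V D oD _ (fun p Dp => sqr_norm_neq0 (f0 p Dp)) n2.
split.
  by apply: eq_C1 (C1_mul oD fr iv) => // p _; rewrite /re_fun Re_inv.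
apply: eq_C1 (C1_mul oD (C1_cst oD (-1)) (C1_mul oD fi iv)) => // p _.
by rewrite /im_fun Im_inv.
Qed.

Lemma cC1_real (v : V -> R) : C1_on D v -> cC1_on D (fun p => (v p)%:C).
Proof. by move=> Cv; split; [exact: Cv | exact: C1_cst]. Qed.

(** [d] is the differential of [g] at [p].  Keeping the differential as a
    function of the direction lets the rules of calculus be composed before any
    direction is chosen. *)
Definition has_cdiff (g : V -> C) (p : V) (d : V -> C) : Prop :=
  cdifferentiable g p /\ forall u, cderive g u p = d u.

Lemma eq_has_cdiff f g p d e : {near p, f =1 g} -> (forall u, d u = e u) ->
  has_cdiff f p d -> has_cdiff g p e.
Proof.
move=> fg de [[dr di] Df].
have fgr : {near p, re_fun f =1 re_fun g}.
  by apply: filterS fg => q; rewrite /re_fun => ->.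
have fgi : {near p, im_fun f =1 im_fun g}.
  by apply: filterS fg => q; rewrite /im_fun => ->.
split; first by split; [exact: near_differentiable dr | exact: near_differentiable di].
move=> u; rewrite -de -Df /cderive.
by rewrite (near_eq_derive u fgr) (near_eq_derive u fgi).
Qed.

Lemma has_cdiff_self g p : cdifferentiable g p -> has_cdiff g p (cderive g ^~ p).
Proof. by []. Qed.

Lemma has_cdiff_cst a p : has_cdiff (cst a) p (fun=> 0).
Proof.
by split=> [|u]; [split; exact: differentiable_cst | rewrite /cderive !derive_cst].
Qed.

Lemma has_cdiff_add f g p d e : has_cdiff f p d -> has_cdiff g p e ->
  has_cdiff (fun q => f q + g q) p (fun u => d u + e u).
Proof.
move=> [[fr fi] Df] [[gr gi] Dg].
have E1 : re_fun (fun q => f q + g q) = re_fun f + re_fun g.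
  by apply/funext => q; rewrite /re_fun Re_add.
have E2 : im_fun (fun q => f q + g q) = im_fun f + im_fun g.
  by apply/funext => q; rewrite /im_fun Im_add.
split; first by rewrite /cdifferentiable E1 E2; split; exact: differentiableD.
move=> u; rewrite -Df -Dg /cderive E1 E2 !deriveD //; exact: diff_derivable.
Qed.

Lemma has_cdiff_mul f g p d e : has_cdiff f p d -> has_cdiff g p e ->
  has_cdiff (fun q => f q * g q) p (fun u => d u * g p + f p * e u).
Proof.
move=> [[fr fi] Df] [[gr gi] Dg].
have E1 : re_fun (fun q => f q * g q) = re_fun f * re_fun g - im_fun f * im_fun g.
  by apply/funext => q; rewrite /re_fun Re_mul mulN1r.
have E2 : im_fun (fun q => f q * g q) = re_fun f * im_fun g + im_fun f * re_fun g.
  by apply/funext => q; rewrite /im_fun Im_mul.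
have mul (h k : V -> R) : differentiable h p -> differentiable k p ->
  differentiable (h * k) p by exact: differentiableM.
split.
  rewrite /cdifferentiable E1 E2.
  by split; [apply: differentiableB | apply: differentiableD]; exact: mul.
move=> u; rewrite -Df -Dg /cderive E1 E2.
have dM (h k : V -> R) : differentiable h p -> differentiable k p ->
   'D_u (h * k) p = h p * 'D_u k p + k p * 'D_u h p.
  by move=> dh dk; apply: deriveM; exact: diff_derivable.
have dr (h k : V -> R) : differentiable h p -> differentiable k p ->
   derivable (h * k) p u.
  by move=> dh dk; apply: diff_derivable; exact: mul.
rewrite deriveB ?deriveD; do ?exact: dr.
rewrite !dM // /re_fun /im_fun.
case: (f p) => a b; case: (g p) => a' b'; apply/eqP; rewrite eq_complex /=.
by apply/andP; split; apply/eqP; ring.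
Qed.

Lemma has_cdiff_sum (I : Type) (r : seq I) (P : pred I) (f : I -> V -> C)
    (d : I -> V -> C) p :
  (forall i, P i -> has_cdiff (f i) p (d i)) ->
  has_cdiff (fun q => \sum_(i <- r | P i) f i q) p
    (fun u => \sum_(i <- r | P i) d i u).
Proof.
move=> Cf; elim: r => [|i r IH].
  by apply: eq_has_cdiff (has_cdiff_cst 0 p) => [|u]; [apply: nearW => q|];
    rewrite big_nil.
have [Pi|nPi] := boolP (P i); last first.
  by apply: eq_has_cdiff IH => [|u]; [apply: nearW => q|];
    rewrite big_cons (negbTE nPi).
by apply: eq_has_cdiff (has_cdiff_add (Cf i Pi) IH) => [|u]; [apply: nearW => q|];
    rewrite big_cons Pi.
Qed.

Lemma has_cdiff_opp f p d : has_cdiff f p d ->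
  has_cdiff (fun q => - f q) p (fun u => - d u).
Proof.
move=> df; apply: eq_has_cdiff (has_cdiff_mul (has_cdiff_cst (-1) p) df) => [|u].
  by apply: nearW => q; rewrite /cst mulN1r.
by rewrite /cst mul0r add0r mulN1r.
Qed.

Lemma has_cdiff_real (v : V -> R) p : differentiable v p ->
  has_cdiff (fun q => (v q)%:C) p (fun u => ('D_u v p)%:C).
Proof.
move=> dv; split=> [|u]; first by split => //; exact: differentiable_cst.
by rewrite /cderive (_ : im_fun _ = cst 0) // derive_cst.
Qed.

Lemma has_cdiff_linear g p d : has_cdiff g p d ->
  forall a u u', d (a *: u + u') = a%:C * d u + d u'.
Proof.
move=> [[dr di] Dg] a u u'; rewrite -!Dg /cderive.
have lin (h : V -> R) : differentiable h p ->
    'D_(a *: u + u') h p = a * 'D_u h p + 'D_u' h p.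
  by move=> dh; rewrite !deriveE // linearP.
rewrite (lin _ dr) (lin _ di); apply/eqP; rewrite eq_complex /=.
by apply/andP; split; apply/eqP; ring.
Qed.

Lemma has_cdiff_uniq g p d e : has_cdiff g p d -> has_cdiff g p e ->
  forall u, d u = e u.
Proof. by move=> [_ Dd] [_ De] u; rewrite -Dd De. Qed.

Lemma has_cdiff_cexp g p d : has_cdiff g p d ->
  has_cdiff (fun q => cexp (g q)) p (fun u => d u * cexp (g p)).
Proof.
move=> [[dr di] Dg].
have [dE DE] := derive_comp1 dr (is_derive_expR (re_fun g p)).
have [dc Dc] := derive_comp1 di (is_derive_cos (im_fun g p)).
have [ds Ds] := derive_comp1 di (is_derive_sin (im_fun g p)).
have E1 : re_fun (fun q => cexp (g q)) = (expR \o re_fun g) * (@cos R \o im_fun g).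
  by [].
have E2 : im_fun (fun q => cexp (g q)) = (expR \o re_fun g) * (@sin R \o im_fun g).
  by [].
split; first by rewrite /cdifferentiable E1 E2; split; exact: differentiableM.
move=> u; rewrite -Dg /cderive E1 E2.
rewrite !deriveM; do ?[exact: diff_derivable]; rewrite DE Dc Ds /cexp.
apply/eqP; rewrite eq_complex /=; apply/andP.
by split; apply/eqP; rewrite /GRing.scale /= /re_fun /im_fun; ring.
Qed.

Lemma cC1_cexp f : cC1_on D f -> cC1_on D (fun p => cexp (f p)).
Proof.
move=> [fr fi].
have CE : C1_on D (expR \o re_fun f).
  by apply: (C1_comp1 oD (h' := expR)) => // p _; exact: continuous_expR.
have Cc : C1_on D (@cos R \o im_fun f).
  apply: (C1_comp1 oD (h' := fun x => - sin x)) => // p _.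
  by apply: cvgN; exact: continuous_sin.
have Cs : C1_on D (@sin R \o im_fun f).
  by apply: (C1_comp1 oD (h' := cos)) => // p _; exact: continuous_cos.
by split; [exact: C1_mul CE Cc | exact: C1_mul CE Cs].
Qed.

End OnOpen.

End ComplexCalculus.

(** * Complex one-forms and linear functions *)

Section ComplexForms.
Set Implicit Arguments.
Unset Strict Implicit.
Context {R : realType}.
Notation C := R[i].

Lemma has_cdiff_ext (V : normedModType R) (g : V -> C) p (d e : V -> C) :
  (forall u, d u = e u) -> has_cdiff g p d -> has_cdiff g p e.
Proof. by move=> de [dg Dg]; split=> // u; rewrite -de. Qed.

Section Composition.
Variables (U V : normedModType R) (L : {linear U -> V}).
Hypothesis cL : continuous L.

Lemma cC1_comp_linear (D : set V) (g : V -> C) :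
  open D -> cC1_on D g -> cC1_on (L @^-1` D) (g \o L).
Proof.
move=> oD [gr gi]; split.
  by have [] := C1_comp_linear oD cL gr.
by have [] := C1_comp_linear oD cL gi.
Qed.

Lemma has_cdiff_comp_linear (g : V -> C) p d :
  has_cdiff g (L p) d -> has_cdiff (g \o L) p (d \o L).
Proof.
move=> [[gr gi] Dg]; have dL : differentiable L p by exact: linear_differentiable.
have D (h : V -> R) u : differentiable h (L p) -> 'D_u (h \o L) p = 'D_(L u) h (L p).
  move=> dh; rewrite !deriveE //; last exact: differentiable_comp.
  by rewrite diff_comp //= diff_lin.
split.
  by split; [exact: (differentiable_comp dL gr) | exact: (differentiable_comp dL gi)].
by move=> u; rewrite /= -Dg /cderive -!D.
Qed.

End Composition.

Section Forms.
Variable m : nat.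
Notation V := 'cV[R]_m.
Implicit Types (w : 'I_m -> V -> C) (D : set V).

Definition cform w (t u : V) : C := \sum_(j < m) w j t * (u j 0)%:C.

Lemma primitive_has_cdiff D g w t : primitive_on D g w -> D t ->
  has_cdiff g t (cform w t).
Proof.
move=> Pg Dt; have [[dr di] Dg] := Pg t Dt; split=> // u.
rewrite /cderive !derive_coord //.
transitivity (\sum_(j < m) cderive g (unitv j) t * (u j 0)%:C); last first.
  by apply: eq_bigr => j _; rewrite Dg.
rewrite [RHS]complexE; apply/eqP; rewrite eq_complex /=; apply/andP; split; apply/eqP.
  elim/big_rec2: _ => // j y1 y2 _ ->; rewrite Re_add Re_mul /=.
  by rewrite /GRing.scale /=; ring.
elim/big_rec2: _ => // j y1 y2 _ ->; rewrite Im_add Im_mul /=.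
by rewrite /GRing.scale /=; ring.
Qed.

Lemma cform_unitv w t j : cform w t (unitv j) = w j t.
Proof.
rewrite /cform (bigD1 j) //= big1 ?addr0 => [|i ij].
  by rewrite /unitv mxE !eqxx mulr1.
by rewrite /unitv mxE (negbTE ij) mulr0.
Qed.

(** The directional derivatives of a primitive are combinations of the
    coefficients of the form, and continuity of these suffices. *)
Lemma primitive_cC1 D g w : open D -> (forall j, cC1_on D (w j)) ->
  primitive_on D g w -> cC1_on D g.
Proof.
move=> oD Cw Pg.
have Df t : D t -> has_cdiff g t (cform w t) by exact: primitive_has_cdiff.
have Cf u : cC1_on D (cform w ^~ u).
  apply: cC1_sum => // j _; apply: cC1_mul => //; exact: cC1_cst.
split.
  apply: (@C1_of_derive _ _ _ oD _ (fun u t => complex.Re (cform w t u))).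
  - by move=> t /Df [[]].
  - by move=> u t /Df [_ /(_ u) <-].
  - by move=> u t Dt; have [Cr _] := Cf u; exact: (C1_continuous Cr Dt).
apply: (@C1_of_derive _ _ _ oD _ (fun u t => complex.Im (cform w t u))).
- by move=> t /Df [[]].
- by move=> u t /Df [_ /(_ u) <-].
- by move=> u t Dt; have [_ Ci] := Cf u; exact: (C1_continuous Ci Dt).
Qed.

Lemma complex_poincare D w : simply_connected_domain (R := R) D ->
  (forall j, cC1_on D (w j)) ->
  (forall i j t, D t -> cderive (w j) (unitv i) t = cderive (w i) (unitv j) t) ->
  exists g, primitive_on D g w.
Proof.
move=> Dsc Cw cw.
have [gr Pr] : exists g, primitive D (fun j => re_fun (w j)) g.
  apply: poincare Dsc => [j|i j t Dt]; first by have [] := Cw j.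
  by have [] := cw i j t Dt.
have [gi Pi] : exists g, primitive D (fun j => im_fun (w j)) g.
  apply: poincare Dsc => [j|i j t Dt]; first by have [] := Cw j.
  by have [] := cw i j t Dt.
exists (fun t => gr t +i* gi t) => t Dt; split.
  by split; [have [] := Pr t Dt | have [] := Pi t Dt].
move=> j; have [_ Dr] := Pr t Dt; have [_ Di] := Pi t Dt.
rewrite [RHS]complexE /cderive.
have -> : re_fun (fun t => gr t +i* gi t) = gr by [].
have -> : im_fun (fun t => gr t +i* gi t) = gi by [].
by rewrite Dr Di !form_unitv.
Qed.

End Forms.

Section Pairing.
Variable n : nat.
Notation V := 'cV[R]_n.
Implicit Types (nu : 'cV[C]_n) (x u : V) (A : 'M[R]_n).

Definition coordinate (i : 'I_n) (x : V) : R := x i 0.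

Lemma coordinate_continuous (i : 'I_n) : continuous (coordinate i).
Proof. exact: (@coord_continuous R). Qed.

Lemma coordinate_is_linear (i : 'I_n) : linear (coordinate i).
Proof. by move=> a x y; rewrite /coordinate !mxE. Qed.

HB.instance Definition _ (i : 'I_n) :=
  GRing.isLinear.Build R V R *:%R (coordinate i) (coordinate_is_linear i).

Lemma has_cdiff_pairing nu x : has_cdiff (pairing nu) x (pairing nu).
Proof.
have h (i : 'I_n) : has_cdiff (fun x : V => nu i 0 * (x i 0)%:C) x
   (fun u => nu i 0 * (u i 0)%:C).
  have dc : differentiable (fun x : V => x i 0 : R) x.
    exact: differentiable_coord.
  apply: has_cdiff_ext (has_cdiff_mul (has_cdiff_cst (nu i 0) x) (has_cdiff_real dc)).
  move=> u /=; rewrite mul0r add0r; congr (_ * _%:C).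
  rewrite deriveE //.
  have := @diff_lin _ _ _ (coordinate i) x (@coordinate_continuous i).
  rewrite /coordinate /= => ->.
  by [].
exact: (@has_cdiff_sum R V _ (index_enum 'I_n) xpredT _ _ x (fun i _ => h i)).
Qed.

Lemma cC1_pairing (D : set V) nu : open D -> cC1_on D (pairing nu).
Proof.
move=> oD; apply: cC1_sum => // i _; apply: cC1_mul => //; first exact: cC1_cst.
apply: cC1_real => //.
by have [] := @C1_linear R V D (coordinate i) oD (@coordinate_continuous i).
Qed.

Lemma pairingDl nu nu' x : pairing (nu + nu') x = pairing nu x + pairing nu' x.
Proof.
by rewrite /pairing -big_split; apply: eq_bigr => i _; rewrite mxE mulrDl.
Qed.

Lemma pairingZl a nu x : pairing (a *: nu) x = a * pairing nu x.
Proof.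
by rewrite /pairing mulr_sumr; apply: eq_bigr => i _; rewrite mxE mulrA.
Qed.

Lemma pairing0l x : pairing (0 : 'cV[C]_n) x = 0.
Proof. by rewrite /pairing big1 // => i _; rewrite mxE mul0r. Qed.

Lemma pairing_suml (I : Type) (r : seq I) (P : pred I) (nus : I -> 'cV[C]_n) x :
  pairing (\sum_(i <- r | P i) nus i) x = \sum_(i <- r | P i) pairing (nus i) x.
Proof.
elim: r => [|i r IH]; first by rewrite !big_nil pairing0l.
by rewrite !big_cons; case: (P i); rewrite ?pairingDl IH.
Qed.

Lemma pairingDr nu x y : pairing nu (x + y) = pairing nu x + pairing nu y.
Proof.
rewrite /pairing -big_split; apply: eq_bigr => i _.
by rewrite mxE rmorphD mulrDr.
Qed.

Lemma pairingBr nu x y : pairing nu (x - y) = pairing nu x - pairing nu y.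
Proof.
rewrite /pairing -sumrB; apply: eq_bigr => i _.
by rewrite !mxE rmorphB mulrBr.
Qed.

Lemma pairing_unitv nu i : pairing nu (unitv i) = nu i 0.
Proof.
rewrite /pairing (bigD1 i) //= big1 ?addr0 => [|j ij].
  by rewrite /unitv mxE !eqxx mulr1.
by rewrite /unitv mxE (negbTE ij) mulr0.
Qed.

(** The vector field of the j-th system is given by the transposed matrix, so
    differentiating the linear function of nu along it applies the matrix to
    nu. *)
Lemma pairing_trmx nu A x : pairing nu (A^T *m x) = pairing (cmx A *m nu) x.
Proof.
rewrite /pairing.
under eq_bigr do rewrite mxE rmorph_sum mulr_sumr.
under [RHS]eq_bigr do rewrite mxE mulr_suml.
rewrite exchange_big; apply: eq_bigr => i _; apply: eq_bigr => j _.
by rewrite !mxE rmorphM /=; ring.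
Qed.

(** Both linear functions are their own differentials, which are determined by
    the values near one point. *)
Lemma pairing_eq_on_open (D : set V) nu nu' : open D -> D !=set0 ->
  (forall x, D x -> pairing nu x = pairing nu' x) -> nu = nu'.
Proof.
move=> oD [x Dx] eqn.
have eqd : forall u, pairing nu u = pairing nu' u.
  apply: has_cdiff_uniq (has_cdiff_pairing nu' x).
  apply: eq_has_cdiff (has_cdiff_pairing nu x) => //.
  exact: (open_near oD Dx).
by apply/matrixP => i k; rewrite ord1 -!pairing_unitv eqd.
Qed.

End Pairing.

End ComplexForms.

(** * Exponential generating functions *)

Section BinomialConvolution.
Set Implicit Arguments.
Unset Strict Implicit.

Section Ring.
Variable F : comNzRingType.
Implicit Types a b c z l : nat -> F.

(** The coefficients of the product of the exponential generating functions
    \sum_n a_n z^n / n! and \sum_n b_n z^n / n!. *)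
Definition conv a b n : F :=
  \sum_(0 <= k < n.+1) 'C(n, k)%:R * a k * b (n - k)%N.

Lemma eq_conv a a' b b' n : (forall k, (k <= n)%N -> a k = a' k) ->
  (forall k, (k <= n)%N -> b k = b' k) -> conv a b n = conv a' b' n.
Proof.
move=> ea eb; apply: eq_big_nat => k /andP[_ kn].
by rewrite ea // eb // leq_subr.
Qed.

Lemma convC a b n : conv a b n = conv b a n.
Proof.
rewrite /conv big_nat_rev; apply: eq_big_nat => k /andP[_ kn].
by rewrite add0n subSS bin_sub // subKn // mulrAC.
Qed.

Lemma conv0 a b : conv a b 0 = a 0%N * b 0%N.
Proof. by rewrite /conv big_nat1 bin0 mul1r. Qed.

Lemma convDl a a' b n : conv (fun k => a k + a' k) b n = conv a b n + conv a' b n.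
Proof. by rewrite /conv -big_split; apply: eq_bigr => k _ /=; ring. Qed.

Lemma convDr a b b' n : conv a (fun k => b k + b' k) n = conv a b n + conv a b' n.
Proof. by rewrite /conv -big_split; apply: eq_bigr => k _ /=; ring. Qed.

Lemma convNr a b n : conv a (fun k => - b k) n = - conv a b n.
Proof. by rewrite /conv -sumrN; apply: eq_bigr => k _ /=; ring. Qed.

Lemma convZr (x : F) a b n : conv a (fun k => b k * x) n = conv a b n * x.
Proof. by rewrite /conv mulr_suml; apply: eq_bigr => k _ /=; ring. Qed.

Lemma conv0l b n : conv (fun=> 0) b n = 0.
Proof. by rewrite /conv big1 // => k _; rewrite mulr0 mul0r. Qed.

Lemma conv0r a n : conv a (fun=> 0) n = 0.
Proof. by rewrite convC conv0l. Qed.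

Lemma conv_sumr (I : Type) (r : seq I) (P : pred I) a (b : I -> nat -> F) n :
  conv a (fun k => \sum_(i <- r | P i) b i k) n =
  \sum_(i <- r | P i) conv a (b i) n.
Proof.
elim: r => [|i r IH].
  by rewrite big_nil -[RHS](conv0r a n); apply: eq_conv => // k _; rewrite big_nil.
rewrite big_cons -IH; case Pi : (P i).
  by rewrite -convDr; apply: eq_conv => // k _; rewrite big_cons Pi.
by apply: eq_conv => // k _; rewrite big_cons Pi.
Qed.

Lemma trinomialC (n k l : nat) : (k + l <= n)%N ->
  ('C(n, k) * 'C(n - k, l) = 'C(n, l) * 'C(n - l, k))%N.
Proof.
move=> kln; have h i j : (i + j <= n)%N ->
    ('C(n, i) * 'C(n - i, j) * (i`! * j`! * (n - i - j)`!) = n`!)%N.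
  move=> ij; rewrite -(@bin_fact n i); last by lia.
  by rewrite -(@bin_fact (n - i) j); [ring | lia].
apply/eqP; rewrite -(eqn_pmul2r (m := k`! * l`! * (n - k - l)`!)).
  rewrite h // [(k`! * _)%N]mulnC subnAC h // addnC //.
by rewrite !muln_gt0 !fact_gt0.
Qed.

(** Both sides sum over the pairs (k, l) with k + l <= n, with the same
    trinomial coefficient. *)
Lemma convCA a b c n : conv a (conv b c) n = conv b (conv a c) n.
Proof.
pose T (a b : nat -> F) (k l : nat) :=
  if (k + l <= n)%N then ('C(n, k) * 'C(n - k, l))%:R * a k * b l * c (n - k - l)%N
  else 0.
have E a' b' : conv a' (conv b' c) n =
    \sum_(0 <= k < n.+1) \sum_(0 <= l < n.+1) T a' b' k l.
  rewrite /conv; apply: eq_big_nat => k /andP[_ kn].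
  rewrite [RHS](@big_cat_nat _ _ _ (n - k).+1) //=; last by lia.
  rewrite [X in _ = _ + X]big_nat_cond [X in _ = _ + X]big1 ?addr0; last first.
    by move=> l; rewrite andbT /T => kl; rewrite ifF //; lia.
  rewrite mulr_sumr; apply: eq_big_nat => l ln.
  by rewrite /T ifT; [rewrite natrM; ring | lia].
rewrite !E exchange_big; apply: eq_bigr => l _; apply: eq_bigr => k _.
rewrite /T addnC; case: ifP => // kl; rewrite trinomialC; last by rewrite addnC.
by rewrite subnAC; ring.
Qed.

(** The Leibniz rule, since the shift of a sequence differentiates its
    generating function; in coefficients it is the rule of Pascal. *)
Lemma conv_shift a b n :
  conv a b n.+1 = conv (fun k => a k.+1) b n + conv a (fun k => b k.+1) n.
Proof.
have E : conv a b n.+1 = \sum_(0 <= k < n.+2) 'C(n, k)%:R * a k * b (n.+1 - k)%N +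
    \sum_(0 <= k < n.+2) (if k is k'.+1 then 'C(n, k')%:R else 0) * a k * b (n.+1 - k)%N.
  rewrite /conv -big_split; apply: eq_bigr => -[|k] _ /=.
    by rewrite !bin0; ring.
  by rewrite binS natrD; ring.
rewrite E addrC; congr (_ + _).
  rewrite big_nat_recl //= !mul0r add0r; apply: eq_bigr => k _.
  by rewrite subSS.
rewrite big_nat_recr //= bin_small // !mul0r addr0.
by apply: eq_big_nat => k kn; rewrite subSn //; lia.
Qed.

Lemma conv_recr z l n :
  conv z l n = \sum_(0 <= k < n) 'C(n, k)%:R * z k * l (n - k)%N + z n * l 0%N.
Proof. by rewrite /conv big_nat_recr //= binn subnn mul1r. Qed.

(** In generating functions: if l' = a l and P' = mu' l + a P, then
    (mu l)' = mu' l + mu a l = mu' l + a (mu l), so mu l solves the same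
    equation as P with the same first term.  The relations are needed below s
    only. *)
Lemma conv_log_derivative s a l P mu :
  (forall n, (n.+1 < s)%N -> l n.+1 = conv a l n) ->
  (forall n, (n.+1 < s)%N ->
     P n.+1 = conv (fun k => mu k.+1) l n + conv a P n) ->
  P 0%N = mu 0%N * l 0%N ->
  forall n, (n < s)%N -> P n = conv mu l n.
Proof.
move=> la Pa P0; elim/ltn_ind => -[_|n IH ns]; first by rewrite conv0.
rewrite Pa // conv_shift; congr (_ + _).
rewrite (@eq_conv a a P (conv mu l)) // => [|k kn]; last first.
  by apply: IH; lia.
rewrite convCA; apply: eq_conv => // k kn; rewrite la //; lia.
Qed.

End Ring.

(** A generating function whose constant term is not 0 is not a zero
    divisor. *)
Lemma conv_eq0 (F : fieldType) (z l : nat -> F) N : l 0%N != 0 ->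
  (forall n, (n < N)%N -> conv z l n = 0) -> forall n, (n < N)%N -> z n = 0.
Proof.
move=> l0 zl; elim/ltn_ind => n IH nN; have := zl n nN.
rewrite conv_recr big_nat_cond big1 ?add0r => [/eqP|k].
  by rewrite mulf_eq0 (negbTE l0) orbF => /eqP.
by rewrite andbT => /andP[_ kn]; rewrite IH ?mulr0 ?mul0r //; lia.
Qed.

Lemma conv_inj (F : fieldType) (z z' l : nat -> F) N : l 0%N != 0 ->
  (forall n, (n < N)%N -> conv z l n = conv z' l n) ->
  forall n, (n < N)%N -> z n = z' n.
Proof.
move=> l0 zl n nN; apply/eqP; rewrite -subr_eq0; apply/eqP.
apply: (@conv_eq0 F (fun k => z k - z' k) l N) => // k kN.
rewrite convDl zl // -convDl -[RHS](conv0l l k); apply: eq_conv => // i _.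
by rewrite subrr.
Qed.

End BinomialConvolution.

(** * Triangular systems of one-forms *)

Section ConvolutionCalculus.
Set Implicit Arguments.
Unset Strict Implicit.
Context {R : realType}.
Notation C := R[i].

(** If a starts with 0, the n-th term involves only the terms of b before the
    n-th: systems of equations of this shape can be solved one after the
    other. *)
Lemma conv_lower (a b : nat -> C) n : a 0%N = 0 ->
  conv a b n = \sum_(k < n) 'C(n, k)%:R * b k * a (n - k)%N.
Proof. by move=> a0; rewrite convC conv_recr a0 mulr0 addr0 big_mkord. Qed.

Lemma eq_conv_lower (a b b' : nat -> C) n : a 0%N = 0 ->
  (forall k, (k < n)%N -> b k = b' k) -> conv a b n = conv a b' n.
Proof.
by move=> a0 bb; rewrite !conv_lower //; apply: eq_bigr => k _; rewrite bb.
Qed.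

Section Calculus.
Variable V : normedModType R.

Lemma has_cdiff_conv (a b : nat -> V -> C) (da db : nat -> V -> C) n p :
  (forall k, (k <= n)%N -> has_cdiff (a k) p (da k)) ->
  (forall k, (k <= n)%N -> has_cdiff (b k) p (db k)) ->
  has_cdiff (fun q => conv (a ^~ q) (b ^~ q) n) p
    (fun u => conv (da ^~ u) (b ^~ p) n + conv (a ^~ p) (db ^~ u) n).
Proof.
move=> Da Db.
have -> : (fun q => conv (a ^~ q) (b ^~ q) n) =
    (fun q => \sum_(k < n.+1) 'C(n, k)%:R * (a k q * b (n - k)%N q)).
  by apply/funext => q; rewrite /conv big_mkord; apply: eq_bigr => k _; rewrite mulrA.
have D (k : 'I_n.+1) := has_cdiff_mul (has_cdiff_cst ('C(n, k)%:R : C) p)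
  (has_cdiff_mul (Da k (ltn_ord k)) (Db (n - k)%N (leq_subr _ _))).
apply: has_cdiff_ext (has_cdiff_sum (index_enum 'I_n.+1) (P := xpredT) (fun k _ => D k)).
move=> u; rewrite /conv !big_mkord -big_split; apply: eq_bigr => k _ /=.
by rewrite /cst; ring.
Qed.

Lemma cC1_conv (D : set V) (a b : nat -> V -> C) n : open D ->
  (forall k, (k <= n)%N -> cC1_on D (a k)) ->
  (forall k, (k <= n)%N -> cC1_on D (b k)) ->
  cC1_on D (fun q => conv (a ^~ q) (b ^~ q) n).
Proof.
move=> oD Ca Cb.
have -> : (fun q => conv (a ^~ q) (b ^~ q) n) =
    (fun q => \sum_(k < n.+1) 'C(n, k)%:R * (a k q * b (n - k)%N q)).
  by apply/funext => q; rewrite /conv big_mkord; apply: eq_bigr => k _; rewrite mulrA.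
apply: (cC1_sum oD) => k _; apply: (cC1_mul oD (cC1_cst oD _)).
by apply: (cC1_mul oD); [apply: Ca; rewrite -ltnS | apply: Cb; exact: leq_subr].
Qed.

(** The triangular relation expresses z_n through L_n, the l_k and the earlier
    z_k, with l_0 as the only denominator. *)
Lemma conv_solve_C1 (D : set V) (z : nat -> V -> R) (l L : nat -> V -> C) N :
  open D ->
  (forall n, (n < N)%N -> forall x, D x ->
     L n x = conv (fun k => (z k x)%:C) (l ^~ x) n) ->
  (forall n, (n < N)%N -> cC1_on D (L n)) ->
  (forall n, (n < N)%N -> cC1_on D (l n)) ->
  (forall x, D x -> l 0%N x != 0) ->
  forall n, (n < N)%N -> C1_on D (z n).
Proof.
move=> oD LE CL Cl l0; elim/ltn_ind => n IH nN.
have Cl0 : cC1_on D (l 0%N) by apply: Cl; exact: leq_ltn_trans nN.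
suff [Cz _] : cC1_on D (fun x => (z n x)%:C) by [].
have Cs : cC1_on D (fun x => \sum_(k < n) 'C(n, k)%:R * ((z k x)%:C * l (n - k)%N x)).
  apply: (cC1_sum oD) => k _; apply: (cC1_mul oD (cC1_cst oD _)).
  have Ck := IH k (ltn_ord k) (ltn_trans (ltn_ord k) nN).
  apply: (cC1_mul oD (cC1_real oD Ck)); apply: Cl.
  exact: leq_ltn_trans (leq_subr _ _) nN.
have Cq := cC1_mul oD (cC1_add oD (CL n nN) (cC1_opp oD Cs)) (cC1_inv oD l0 Cl0).
apply: (eq_cC1 oD _ Cq) => x Dx /=; rewrite LE // conv_recr big_mkord.
under [X in _ - X]eq_bigr do rewrite mulrA.
by rewrite [X in (X - _) / _]addrC addrK mulfK // l0.
Qed.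

End Calculus.

Section TriangularPrimitives.
Variables (m : nat) (D : set 'cV[R]_m).
Notation V := 'cV[R]_m.
Hypothesis D_sc : simply_connected_domain (R := R) D.
Let oD : open D := let: conj (And3 _ o _) _ := D_sc in o.

Lemma triangular_primitives_C1 s (mu : 'I_m -> nat -> C)
    (a : 'I_m -> nat -> V -> C) (G : nat -> V -> C) :
  (forall j, mu j 0%N = 0) ->
  (forall j th, (th < s)%N -> cC1_on D (a j th)) ->
  (forall th, (th < s)%N -> primitive_on D (G th)
     (fun j t => a j th t + conv (mu j) (G ^~ t) th)) ->
  forall th, (th < s)%N ->
    cC1_on D (G th) /\ forall j, cC1_on D (fun t => conv (mu j) (G ^~ t) th).
Proof.
move=> mu0 Ca PG; elim/ltn_ind => th IH ths.
have Cc j : cC1_on D (fun t => conv (mu j) (G ^~ t) th).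
  have -> : (fun t => conv (mu j) (G ^~ t) th) =
      (fun t => \sum_(k < th) ('C(th, k)%:R * mu j (th - k)%N) * G k t).
    by apply/funext => t; rewrite conv_lower //; apply: eq_bigr => k _; ring.
  apply: (cC1_sum oD) => k _; apply: (cC1_mul oD (cC1_cst oD _)).
  by have [] := IH k (ltn_ord k) (ltn_trans (ltn_ord k) ths).
split; last exact: Cc.
apply: (primitive_cC1 oD _ (PG th ths)) => j.
exact: (cC1_add oD (Ca j th ths) (Cc j)).
Qed.

(** The system dG = a + mu G with mu starting with 0.  Differentiating the form
    of G_th once more gives da + mu a + mu (mu G); the last term is symmetric in
    the two indices since convolutions commute, and the last hypothesis says
    that the rest is too.  The first b functions may be prescribed as constants. *)
Lemma triangular_primitives s b (mu : 'I_m -> nat -> C)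
    (a : 'I_m -> nat -> V -> C) (c : nat -> C) :
  (forall j, mu j 0%N = 0) ->
  (forall j th, (th < s)%N -> cC1_on D (a j th)) ->
  (forall th, (th < b)%N -> (th < s)%N -> forall j t, D t ->
     a j th t + conv (mu j) c th = 0) ->
  (forall th i j t, (th < s)%N -> D t ->
     cderive (a j th) (unitv i) t + conv (mu j) (fun k => a i k t) th =
     cderive (a i th) (unitv j) t + conv (mu i) (fun k => a j k t) th) ->
  exists G : nat -> V -> C,
    (forall th t, (th < s)%N -> (th < b)%N -> G th t = c th) /\
    forall th, (th < s)%N -> primitive_on D (G th)
      (fun j t => a j th t + conv (mu j) (G ^~ t) th).
Proof.
move=> mu0; elim: s => [|s IH] Ca Cb curl; first by exists (fun _ _ => 0).
have [| | |G [Gc PG]] := IH.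
- by move=> j th ths; apply: Ca; exact: ltnW.
- by move=> th thb ths; apply: Cb => //; exact: ltnW.
- by move=> th i j t ths; apply: curl; exact: ltnW.
have CG := triangular_primitives_C1 mu0 (fun j th ths => Ca j th (ltnW ths)) PG.
have [g [gc Pg]] : exists g : V -> C, ((s < b)%N -> forall t, g t = c s) /\
    primitive_on D g (fun j t => a j s t + conv (mu j) (G ^~ t) s).
  have [sb|bs] := ltnP s b.
    exists (cst (c s)); split=> // t Dt.
    have [dc Dc] := has_cdiff_cst (c s) t.
    split=> // j; rewrite Dc; apply/esym; rewrite -(Cb s sb (ltnSn s) j t Dt).
    congr (_ + _); apply: eq_conv_lower => // k ks.
    by rewrite Gc // (ltn_trans ks).
  have Cw j : cC1_on D (fun t => conv (mu j) (G ^~ t) s).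
    have -> : (fun t => conv (mu j) (G ^~ t) s) =
        (fun t => \sum_(k < s) ('C(s, k)%:R * mu j (s - k)%N) * G k t).
      by apply/funext => t; rewrite conv_lower //; apply: eq_bigr => k _; ring.
    apply: (cC1_sum oD) => k _; apply: (cC1_mul oD (cC1_cst oD _)).
    by have [] := CG k (ltn_ord k).
  have [j|i j t Dt|g Pg] := complex_poincare (w := fun j t =>
      a j s t + conv (mu j) (G ^~ t) s) D_sc.
  - exact: (cC1_add oD (Ca j s (ltnSn s)) (Cw j)).
  - have dw i' j' : cderive (fun t => a j' s t + conv (mu j') (G ^~ t) s) (unitv i') t =
        cderive (a j' s) (unitv i') t + conv (mu j') (fun k => a i' k t) s +
        conv (mu j') (conv (mu i') (G ^~ t)) s.
      have da := has_cdiff_self (cC1_cdifferentiable (Ca j' s (ltnSn s)) Dt).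
      have dG (k : 'I_s) := has_cdiff_mul
        (has_cdiff_cst ('C(s, k)%:R * mu j' (s - k)%N : C) t)
        (primitive_has_cdiff (PG k (ltn_ord k)) Dt).
      have dS := has_cdiff_sum (index_enum 'I_s) (P := xpredT) (fun k _ => dG k).
      have E : (fun t => a j' s t + conv (mu j') (G ^~ t) s) =
         (fun t => a j' s t + \sum_(k < s) ('C(s, k)%:R * mu j' (s - k)%N) * G k t).
        apply/funext => t'; congr (_ + _); rewrite conv_lower //.
        by apply: eq_bigr => k _; ring.
      have [_ dT] := has_cdiff_add da dS; rewrite E dT.
      rewrite -addrA -convDr; congr (_ + _).
      rewrite conv_lower //; apply: eq_bigr => k _.
      by rewrite cform_unitv /cst; ring.
    by rewrite !dw curl // convCA.
  by exists g; split=> // sb; move: bs; rewrite leqNgt sb.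
(* Changing G at s changes no convolution up to s, as mu starts with 0. *)
pose G' th := if th == s then g else G th.
have GG' th j t : (th <= s)%N ->
    conv (mu j) (G' ^~ t) th = conv (mu j) (G ^~ t) th.
  by move=> ths; apply: eq_conv_lower => // k kth; rewrite /G' ifF //; lia.
exists G'; split=> th.
  move=> t; rewrite ltnS leq_eqVlt /G' => /orP[/eqP ->|ths] sb.
    by rewrite eqxx gc.
  by rewrite ifF ?Gc //; lia.
move=> ths; have thes : (th <= s)%N by [].
suff : primitive_on D (G' th) (fun j t => a j th t + conv (mu j) (G ^~ t) th).
  by move=> P t Dt; have [d Pd] := P t Dt; split=> // j; rewrite Pd GG'.
move: ths; rewrite ltnS leq_eqVlt /G' => /orP[/eqP ->|ths]; first by rewrite eqxx.
by rewrite ifF; [exact: PG | lia].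
Qed.

End TriangularPrimitives.

End ConvolutionCalculus.

(** * The functions p_j v_theta *)

Section CommonEigenvector.
Set Implicit Arguments.
Unset Strict Implicit.
Variables (R : realType) (m n : nat) (A : 'I_m -> 'M[R]_n) (zeta : 'I_m).
Variables (nu : nat -> 'cV[R[i]]_n) (lambda : 'I_m -> R[i]) (s : nat).
Variables (X : set 'cV[R]_n) (v : nat -> 'cV[R]_n -> R).
Notation C := R[i].
Notation V := 'cV[R]_n.

Hypothesis A_comm : forall j z, A j *m A z = A z *m A j.
Hypothesis nu0_eigen : forall j, cmx (A j) *m nu 0%N = lambda j *: nu 0%N.
Hypothesis nu_gen : generalized_eigenvectors (cmx (A zeta)) (lambda zeta) s nu.
Hypothesis X_open : open X.
Hypothesis X_neq0 : X !=set0.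
Hypothesis nu0_neq0 : forall x, X x -> pairing (nu 0%N) x != 0.
Hypothesis v_rec : forall theta x, (1 <= theta < s)%N -> X x ->
  pairing (nu theta) x = \sum_(1 <= delta < theta.+1)
    'C(theta.-1, delta.-1)%:R * (v delta x)%:C * pairing (nu (theta - delta)%N) x.
Hypothesis no_integral : forall j theta, j != zeta -> (1 <= theta < s)%N ->
  ~ ode_first_integral A X zeta (pop A j (v theta)).

(* As generating functions in the index k: [l] is l, [P j] is p_j l, [vc] is v'
   and [wc j] is (p_j v)'. *)
Let l k (x : V) : C := pairing (nu k) x.
Let P j k (x : V) : C := pairing (cmx (A j) *m nu k) x.
Let vc k (x : V) : C := (v k.+1 x)%:C.
Let w j k (x : V) : R := pop A j (v k.+1) x.
Let wc j k (x : V) : C := (w j k x)%:C.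
Let B j (x : V) : V := (A j)^T *m x.

Lemma l_recursion x k : X x -> (k.+1 < s)%N ->
  l k.+1 x = conv (vc ^~ x) (l ^~ x) k.
Proof. by move=> Xx ks; rewrite /l v_rec // big_add1. Qed.

Lemma cC1_l k : cC1_on X (l k).
Proof. exact: cC1_pairing. Qed.

Lemma cC1_A_nu j k : cC1_on X (P j k).
Proof. exact: cC1_pairing. Qed.

(** The triangular relation makes the functions v rational in the linear
    functions l, with powers of l_0 as denominators. *)
Lemma v_C1 k : (k.+1 < s)%N -> C1_on X (v k.+1).
Proof.
move=> ks; apply: (@conv_solve_C1 R V X (fun k => v k.+1) l (fun k => l k.+1)
  s.-1 X_open) => //; last by lia.
- by move=> i ik x Xx; rewrite l_recursion //; lia.
- by move=> i _; exact: cC1_l.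
- by move=> i _; exact: cC1_l.
Qed.

Lemma cC1_vc k : (k.+1 < s)%N -> cC1_on X (vc k).
Proof. by move=> ks; exact: (cC1_real X_open (v_C1 ks)). Qed.

Lemma pop_derive (g : V -> R) j x : differentiable g x ->
  pop A j g x = 'D_(B j x) g x.
Proof. by move=> dg; rewrite derive_coord. Qed.

Lemma cderive_pairing (mu : 'cV[C]_n) u x : cderive (pairing mu) u x = pairing mu u.
Proof. by have [_] := has_cdiff_pairing mu x. Qed.

Lemma has_cdiff_conv_X (a b : nat -> V -> C) k x : X x ->
  (forall i, (i <= k)%N -> cC1_on X (a i)) ->
  (forall i, (i <= k)%N -> cC1_on X (b i)) ->
  has_cdiff (fun y => conv (a ^~ y) (b ^~ y) k) x
    (fun u => conv (fun i => cderive (a i) u x) (b ^~ x) k +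
              conv (a ^~ x) (fun i => cderive (b i) u x) k).
Proof.
move=> Xx Ca Cb; apply: has_cdiff_conv => i ik; apply: has_cdiff_self.
  exact: (cC1_cdifferentiable (Ca i ik) Xx).
exact: (cC1_cdifferentiable (Cb i ik) Xx).
Qed.

Lemma cderive_vc j k x : X x -> (k.+1 < s)%N -> cderive (vc k) (B j x) x = wc j k x.
Proof.
move=> Xx ks; have [dv _] := v_C1 ks Xx.
by have [_ ->] := has_cdiff_real dv; rewrite /wc /w pop_derive.
Qed.

(** The recursion of l differentiated along the j-th vector field. *)
Lemma A_nu_recursion j x k : X x -> (k.+1 < s)%N ->
  P j k.+1 x = conv (wc j ^~ x) (l ^~ x) k + conv (vc ^~ x) (P j ^~ x) k.
Proof.
move=> Xx ks.
have Cv i : (i <= k)%N -> cC1_on X (vc i) by move=> ik; apply: cC1_vc; lia.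
have Cl i : (i <= k)%N -> cC1_on X (l i) by move=> _; exact: cC1_l.
have near_l : {near x, (fun y => conv (vc ^~ y) (l ^~ y) k) =1 l k.+1}.
  by apply: (open_near X_open Xx) => y Xy; rewrite l_recursion.
have [_ dl] := eq_has_cdiff near_l (fun=> erefl) (has_cdiff_conv_X Xx Cv Cl).
rewrite /P -pairing_trmx -(cderive_pairing _ _ x) -/(B j x) -/(l k.+1) dl.
congr (_ + _); apply: eq_conv => // i ik; first by rewrite cderive_vc //; lia.
by rewrite /l cderive_pairing pairing_trmx.
Qed.

(** The recursion of [A_nu_recursion] expresses p_j v without derivatives of v,
    which spares second derivatives of v. *)
Lemma pop_v_C1 j k : (k.+1 < s)%N -> C1_on X (w j k).
Proof.
move=> ks; apply: (@conv_solve_C1 R V X (w j) l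
  (fun k x => P j k.+1 x + - conv (vc ^~ x) (P j ^~ x) k) s.-1 X_open) => //; last by lia.
- by move=> i ik x Xx; rewrite A_nu_recursion ?addrK //; lia.
- move=> i ik; apply: (cC1_add X_open (cC1_A_nu j i.+1)); apply: (cC1_opp X_open).
  apply: (cC1_conv X_open) => i' ii'; last exact: cC1_A_nu.
  by apply: cC1_vc; lia.
- by move=> i _; exact: cC1_l.
Qed.

(** The sequence mu_j at the point x, before it is known to be constant. *)
Definition local_mu j (x : V) k : C := if k is k'.+1 then wc j k' x else lambda j.

Lemma A_nu_conv j x k : X x -> (k < s)%N -> P j k x = conv (local_mu j x) (l ^~ x) k.
Proof.
move=> Xx; apply: (@conv_log_derivative _ s (vc ^~ x) (l ^~ x) (P j ^~ x)).
- by move=> i; exact: l_recursion.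
- by move=> i; exact: A_nu_recursion.
- by rewrite /P nu0_eigen pairingZl.
Qed.

(** The generating function lambda + z: multiplying by it is how A_zeta acts on
    the generalized eigenvectors. *)
Definition zeta_mu k : C := if k is k'.+1 then (k' == 0%N)%:R else lambda zeta.

Lemma conv_zeta_mu (b : nat -> C) k :
  conv zeta_mu b k = lambda zeta * b k + k%:R * b k.-1.
Proof.
case: k => [|k]; first by rewrite conv0 mul0r addr0.
rewrite /conv big_nat_recl // big_nat_recl // big_nat_cond big1 ?addr0 => [|i _].
  by rewrite bin0 bin1 subn0 subSS subn0 /zeta_mu /= mul1r mulr1.
by rewrite /zeta_mu /= mulr0 mul0r.
Qed.

Lemma A_zeta_nu k : (k < s)%N ->
  cmx (A zeta) *m nu k = lambda zeta *: nu k + k%:R *: nu k.-1.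
Proof.
case: k => [|k] ks; first by rewrite nu0_eigen scale0r addr0.
have [_] := nu_gen (theta := k.+1) ks.
by rewrite mulmxBl mul_scalar_mx => /eqP; rewrite subr_eq addrC => /eqP.
Qed.

(** Both p_zeta l = (lambda + z) l and p_zeta l = (lambda + p_zeta v) l hold,
    and l may be cancelled. *)
Lemma pop_zeta_v x k : X x -> (k.+1 < s)%N -> wc zeta k x = zeta_mu k.+1.
Proof.
move=> Xx ks.
apply: (@conv_inj _ (wc zeta ^~ x) (fun k => zeta_mu k.+1) (l ^~ x) s.-1);
  [exact: nu0_neq0 | | lia] => i ik.
have is_ : (i.+1 < s)%N by lia.
have PE i' : (i' < s)%N -> P zeta i' x = conv zeta_mu (l ^~ x) i'.
  by move=> ii; rewrite conv_zeta_mu /P A_zeta_nu // pairingDl !pairingZl.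
apply: (@addIr _ (conv (vc ^~ x) (P zeta ^~ x) i)).
rewrite -A_nu_recursion // PE // conv_shift; congr (_ + _).
rewrite (@eq_conv _ zeta_mu zeta_mu _ (conv (vc ^~ x) (l ^~ x))) //; last first.
  by move=> i' ii'; rewrite l_recursion //; lia.
by rewrite convCA; apply: eq_conv => // i' ii'; rewrite PE //; lia.
Qed.

(** Applying p_zeta to (p_j l)' = (p_j v)' l + v' (p_j l) and replacing
    p_zeta (p_j l) = p_j (p_zeta l) by (lambda + z) p_j l leaves
    (p_zeta p_j v)' l = 0. *)
Lemma pop_zeta_pop_v j x k : X x -> (k.+1 < s)%N ->
  cderive (wc j k) (B zeta x) x = 0.
Proof.
move=> Xx ks; pose u := B zeta x.
apply: (@conv_eq0 _ (fun k => cderive (wc j k) u x) (l ^~ x) s.-1);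
  [exact: nu0_neq0 | | lia] => i ik.
have is_ : (i.+1 < s)%N by lia.
have Cv i' : (i' <= i)%N -> cC1_on X (vc i') by move=> ii; apply: cC1_vc; lia.
have Cl i' : (i' <= i)%N -> cC1_on X (l i') by move=> _; exact: cC1_l.
have CP i' : (i' <= i)%N -> cC1_on X (P j i') by move=> _; exact: cC1_A_nu.
have Cw i' : (i' <= i)%N -> cC1_on X (wc j i').
  by move=> ii; apply: (cC1_real X_open); apply: pop_v_C1; lia.
have near_P : {near x, (fun y => conv (wc j ^~ y) (l ^~ y) i +
    conv (vc ^~ y) (P j ^~ y) i) =1 P j i.+1}.
  by apply: (open_near X_open Xx) => y Xy; rewrite A_nu_recursion.
have [_ dP] := eq_has_cdiff near_P (fun=> erefl)
  (has_cdiff_add (has_cdiff_conv_X Xx Cw Cl) (has_cdiff_conv_X Xx Cv CP)).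
have PP i' : (i' < s)%N -> cderive (P j i') u x = conv zeta_mu (P j ^~ x) i'.
  move=> ii; rewrite conv_zeta_mu /P cderive_pairing /u /B pairing_trmx.
  rewrite mulmxA -!map_mxM A_comm map_mxM -mulmxA A_zeta_nu //.
  by rewrite mulmxDr -!scalemxAr pairingDl !pairingZl.
have Pz i' : (i' <= i)%N -> cderive (l i') u x = P zeta i' x.
  by move=> _; rewrite /l cderive_pairing pairing_trmx.
have PzE i' : (i' <= i)%N -> conv zeta_mu (l ^~ x) i' = P zeta i' x.
  by move=> ii; rewrite conv_zeta_mu /P A_zeta_nu ?pairingDl ?pairingZl //; lia.
have := dP u; rewrite PP // conv_shift.
rewrite (@eq_conv _ zeta_mu zeta_mu (fun k => P j k.+1 x)
  (fun k => conv (wc j ^~ x) (l ^~ x) k + conv (vc ^~ x) (P j ^~ x) k)) //; last first.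
  by move=> i' ii; rewrite A_nu_recursion //; lia.
rewrite convDr convCA (@convCA _ zeta_mu (vc ^~ x)).
rewrite (@eq_conv _ (wc j ^~ x) (wc j ^~ x) _ (P zeta ^~ x)) //.
rewrite [X in _ = _ + X + _](@eq_conv _ (wc j ^~ x) (wc j ^~ x) _ (P zeta ^~ x)) //.
rewrite [X in _ = _ + (X + _)](@eq_conv _ _ (fun k => zeta_mu k.+1) _ (P j ^~ x)) //;
  last by move=> i' ii; rewrite cderive_vc ?pop_zeta_v //; lia.
rewrite [X in _ = _ + (_ + X)](@eq_conv _ (vc ^~ x) (vc ^~ x) _
    (conv zeta_mu (P j ^~ x))) //;
  last by move=> i' ii; rewrite PP //; lia.
move=> /eqP; rewrite eq_sym -subr_eq0 => /eqP E; rewrite -[RHS]E; ring.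
Qed.

Lemma pop_v_constant j k x y : X x -> X y -> (k.+1 < s)%N -> w j k x = w j k y.
Proof.
move=> Xx Xy ks; have [jz|jz] := eqVneq j zeta.
  have := pop_zeta_v Xx ks; rewrite -(pop_zeta_v Xy ks) jz /wc => E.
  by have [] : complex.Re (w zeta k x)%:C = complex.Re (w zeta k y)%:C by rewrite E.
apply: contrapT => wxy; have := @no_integral j k.+1 jz ks; apply.
split; [by exists x, y | exact: pop_v_C1 | move=> z Xz].
have [dw _] := pop_v_C1 j ks Xz.
rewrite -/(w j k) pop_derive //; have := pop_zeta_pop_v j Xz ks.
by have [_ ->] := has_cdiff_real dw => -[].
Qed.

(** On X the linear functions of both sides agree, so the vectors do; in
    particular y ranges over the whole space, and may be a value of f. *)
Lemma pairing_A_nu x0 j k y : X x0 -> (k < s)%N ->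
  pairing (cmx (A j) *m nu k) y = conv (local_mu j x0) (fun i => pairing (nu i) y) k.
Proof.
move=> Xx0 ks.
have convE z : conv (local_mu j x0) (fun i => pairing (nu i) z) k =
    pairing (\sum_(0 <= i < k.+1) ('C(k, i)%:R * local_mu j x0 i) *: nu (k - i)%N) z.
  by rewrite pairing_suml; apply: eq_bigr => i _; rewrite pairingZl.
rewrite convE; congr (pairing _ y); apply: (pairing_eq_on_open X_open X_neq0) => z Xz.
rewrite -convE -/(P j k z) A_nu_conv //; apply: eq_conv => // -[|i] ik //=.
by congr (_%:C); apply: pop_v_constant => //; lia.
Qed.

End CommonEigenvector.

(** * The first integrals *)

Section FirstIntegrals.
Set Implicit Arguments.
Unset Strict Implicit.
Variables (R : realType) (m n : nat) (A : 'I_m -> 'M[R]_n).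
Variables (f : 'I_m -> 'cV[R]_m -> 'cV[R]_n) (T' : set 'cV[R]_m) (X : set 'cV[R]_n).
Variables (nu : nat -> 'cV[R[i]]_n) (mu : 'I_m -> nat -> R[i]) (s : nat).
Notation C := R[i].
Notation Vt := 'cV[R]_m.
Notation Vx := 'cV[R]_n.

Hypothesis T'_sc : simply_connected_domain (R := R) T'.
Hypothesis X_open : open X.
Hypothesis f_C1 : forall j, C1_on T' (f j).
Hypothesis solvable : forall j z t, T' t ->
  'D_(unitv z) (f j) t - (A z)^T *m f j t = 'D_(unitv j) (f z) t - (A j)^T *m f z t.
Hypothesis A_nu : forall j k y, (k < s)%N ->
  pairing (cmx (A j) *m nu k) y = conv (mu j) (fun i => pairing (nu i) y) k.

Let T'_open : open T' := let: conj (And3 _ o _) _ := T'_sc in o.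

(** The generating function of mu_j without its constant term: the constant term
    is absorbed by the factor phi. *)
Definition mu_plus j k : C := if k is 0%N then 0 else mu j k.

Lemma mu_plus0 j : mu_plus j 0%N = 0. Proof. by []. Qed.

Lemma conv_mu j b k : conv (mu j) b k = mu j 0%N * b k + conv (mu_plus j) b k.
Proof.
rewrite /conv big_nat_recl // [X in _ = _ + X]big_nat_recl // bin0 subn0.
by rewrite mu_plus0 mulr0 mul0r add0r mul1r.
Qed.

Lemma C_formE (Cs : nat -> Vt -> C) k j t :
  C_form f nu mu Cs k j t =
  pairing (nu k) (f j t) * phi mu t + conv (mu_plus j) (Cs ^~ t) k.
Proof.
rewrite /C_form; congr (_ + _); rewrite /conv [RHS]big_nat_recl // mulr0 mul0r add0r.
by rewrite big_add1.
Qed.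

(** The functions K_p completed by K_p^p = 1 and by K_p^k = 0 for k < p, which
    turns the special first term of the forms into an ordinary one. *)
Definition unitri (K : nat -> nat -> Vt -> C) p k t : C :=
  if (k <= p)%N then (k == p)%:R else K p k t.

Lemma K_formE K p k j t : (p < k)%N ->
  K_form mu K p.+1 k j t = conv (mu_plus j) (fun i => unitri K p i t) k.
Proof.
move=> pk; rewrite /K_form /= subnSK //.
rewrite /conv [RHS](@big_cat_nat _ _ _ (k - p)) //=; last by lia.
rewrite addrC; congr (_ + _); last first.
  rewrite [RHS]big_ltn ?subn_gt0 // mulr0 mul0r add0r.
  apply: eq_big_nat => i /andP[i0 ik]; rewrite /unitri ifF; last by lia.
  by case: i i0 ik.
rewrite [RHS]big_ltn; last by lia.
rewrite [X in _ = _ + X]big_nat_cond [X in _ = _ + X]big1 ?addr0 => [|i].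
  rewrite /unitri subKn ?leqnn ?eqxx ?mulr1 ?(ltnW pk) // bin_sub ?(ltnW pk) //.
  by congr (_ * _); case E : (k - p)%N => //; lia.
rewrite andbT => ik; rewrite /unitri ifT; last by lia.
by rewrite (_ : (k - i == p)%N = false) ?mulr0 //; lia.
Qed.

Let mu0 : 'cV[C]_m := \col_j mu j 0%N.

Lemma phiE : phi mu = (fun t => cexp (- pairing mu0 t)).
Proof.
apply/funext => t; rewrite /phi /pairing; congr (cexp (- _)).
by apply: eq_bigr => j _; rewrite mxE.
Qed.

Lemma has_cdiff_phi t : has_cdiff (phi mu) t (fun u => - pairing mu0 u * phi mu t).
Proof.
rewrite phiE; exact: has_cdiff_cexp (has_cdiff_opp (has_cdiff_pairing mu0 t)).
Qed.

Lemma pairing_mu0_unitv j : pairing mu0 (unitv j) = mu j 0%N.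
Proof. by rewrite pairing_unitv mxE. Qed.

Lemma cC1_phi : cC1_on T' (phi mu).
Proof.
by rewrite phiE; apply: (cC1_cexp T'_open); apply: (cC1_opp T'_open); exact: cC1_pairing.
Qed.

Lemma C1_coord j i : C1_on T' (fun t => f j t i 0) /\
  forall t u, T' t -> 'D_u (fun t => f j t i 0) t = ('D_u (f j) t) i 0.
Proof.
have dcoord (y : Vx) : differentiable (coordinate i) y by exact: differentiable_coord.
have D u t : T' t -> 'D_u (coordinate i \o f j) t = ('D_u (f j) t) i 0.
  move=> T't; have [df _] := f_C1 j T't.
  rewrite deriveE; last exact: differentiable_comp.
  rewrite diff_comp //= [in RHS]deriveE //.
  have := @diff_lin _ _ _ (coordinate i) (f j t) (@coordinate_continuous R n i).
  by move=> ->.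
split; last by move=> t u; exact: D.
apply: (@C1_of_derive R _ T' T'_open (coordinate i \o f j)
  (fun u t => ('D_u (f j) t) i 0)) => // [t T't|u t T't].
  by have [df _] := f_C1 j T't; exact: differentiable_comp.
have [_ /(_ u) cf] := f_C1 j T't.
apply: (@continuous_comp _ _ _ (fun t => 'D_u (f j) t) (fun y : Vx => y i 0)).
  exact: cf.
exact: (@coord_continuous R).
Qed.

Lemma has_cdiff_pairing_f (nu' : 'cV[C]_n) j t : T' t ->
  has_cdiff (fun t => pairing nu' (f j t)) t (fun u => pairing nu' ('D_u (f j) t)).
Proof.
move=> T't.
have h i : has_cdiff (fun t => nu' i 0 * (f j t i 0)%:C) t
    (fun u => 0 * (f j t i 0)%:C + nu' i 0 * ('D_u (fun t => f j t i 0) t)%:C).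
  have [Cf _] := C1_coord j i; have [df _] := Cf t T't.
  exact: has_cdiff_mul (has_cdiff_cst (nu' i 0) t) (has_cdiff_real df).
apply: has_cdiff_ext (has_cdiff_sum (index_enum 'I_n) (P := xpredT) (fun i _ => h i)).
move=> u; rewrite /pairing; apply: eq_bigr => i _.
by have [_ ->] := C1_coord j i; rewrite ?mul0r ?add0r.
Qed.

Lemma cC1_pairing_f (nu' : 'cV[C]_n) j : cC1_on T' (fun t => pairing nu' (f j t)).
Proof.
apply: (cC1_sum T'_open) => i _; apply: (cC1_mul T'_open (cC1_cst T'_open _)).
by apply: (cC1_real T'_open); have [] := C1_coord j i.
Qed.

Let source j k t := pairing (nu k) (f j t) * phi mu t.

(** Convolution with mu_j turns nu^k f_i into (A_j nu^k) f_i, and mu_j^+ lacks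
    the term with mu_j0. *)
Lemma conv_source j i k t : (k < s)%N ->
  conv (mu_plus j) (fun k => source i k t) k =
  (pairing (cmx (A j) *m nu k) (f i t) - mu j 0%N * pairing (nu k) (f i t)) * phi mu t.
Proof.
by move=> ks; rewrite /source convZr A_nu // conv_mu [X in (X - _) * _]addrC addrK.
Qed.

(** After division by phi the difference of the two sides is nu^k applied to the
    condition of complete solvability. *)
Lemma source_curl k i j t : (k < s)%N -> T' t ->
  cderive (source j k) (unitv i) t + conv (mu_plus j) (fun k => source i k t) k =
  cderive (source i k) (unitv j) t + conv (mu_plus i) (fun k => source j k t) k.
Proof.
move=> ks T't; rewrite !conv_source //.
have d i' j' : cderive (source j' k) (unitv i') t =
    (pairing (nu k) ('D_(unitv i') (f j') t) - mu i' 0%N * pairing (nu k) (f j' t))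
    * phi mu t.
  have [_ ->] := has_cdiff_mul (has_cdiff_pairing_f (nu k) j' T't) (has_cdiff_phi t).
  by rewrite pairing_mu0_unitv; ring.
have := congr1 (pairing (nu k)) (solvable j i T't).
rewrite !pairingBr !pairing_trmx !d => /eqP; rewrite -subr_eq0 => /eqP E.
apply/eqP; rewrite -subr_eq0; apply/eqP; rewrite -[RHS](mul0r (phi mu t)) -E.
move: (pairing _ ('D__ (f j) t)) (pairing _ ('D__ (f i) t)) => a b.
move: (pairing (_ *m _) (f j t)) (pairing (_ *m _) (f i t)) => c d'.
move: (pairing _ (f j t)) (pairing _ (f i t)) (phi mu t) => e g x; ring.
Qed.

Lemma KC_exist : exists K Cs, KC_primitives f nu mu T' s K Cs.
Proof.
have columns p : exists G : nat -> Vt -> C,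
    (forall k t, (k < s)%N -> (k < p.+1)%N -> G k t = (k == p)%:R) /\
    forall k, (k < s)%N -> primitive_on T' (G k)
      (fun j t => 0 + conv (mu_plus j) (G ^~ t) k).
  apply: (@triangular_primitives R m T' T'_sc s p.+1 mu_plus (fun _ _ _ => 0)
    (fun k => (k == p)%:R)) => //.
  - by move=> j k _; exact: (cC1_cst T'_open 0).
  - move=> k kp _ j t _; rewrite add0r conv_lower // big1 // => i _.
    by rewrite (_ : (i == p :> nat) = false) ?mulr0 ?mul0r //; have := ltn_ord i; lia.
  - move=> k i j t _ _; rewrite !conv0r !addr0.
    by have [_ d0] := has_cdiff_cst (0 : C) t; rewrite !d0.
have [K HK] := boolp.choice columns.
have [Cs [_ PC]] : exists G : nat -> Vt -> C,
    (forall k t, (k < s)%N -> (k < 0)%N -> G k t = 0) /\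
    forall k, (k < s)%N -> primitive_on T' (G k)
      (fun j t => source j k t + conv (mu_plus j) (G ^~ t) k).
  apply: (@triangular_primitives R m T' T'_sc s 0 mu_plus source (fun=> 0)) => //.
  - move=> j k _; exact: (cC1_mul T'_open (cC1_pairing_f (nu k) j) cC1_phi).
  - exact: source_curl.
exists K, Cs; split=> [k tau /andP[_ ks] /andP[t0 tk] t T't|k ks t T't]; last first.
  by have [d D] := PC k ks t T't; split=> // j; rewrite D C_formE.
have [Kc PK] := HK tau.-1; have [d D] := PK k ks t T't; split=> // j.
rewrite D add0r -[in RHS](prednK t0) K_formE; last by lia.
apply: eq_conv => // i ik; rewrite /unitri; case: leqP => // ip.
by rewrite Kc //; lia.
Qed.

Lemma F_exist K Cs : exists F, F_recursion nu mu T' X s K Cs F.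
Proof.
suff [F HF] : exists F : nat -> Vt * Vx -> C, forall k t x, (k < s)%N ->
    F k (t, x) = pairing (nu k) x * phi mu t
      - \sum_(1 <= tau < k.+1) K tau.-1 k t * F tau.-1 (t, x) - Cs k t.
  by exists F => k t x ks _ _; exact: HF.
elim: s => [|k [F HF]]; first by exists (fun _ _ => 0).
pose g (p : Vt * Vx) := pairing (nu k) p.2 * phi mu p.1
  - \sum_(1 <= tau < k.+1) K tau.-1 k p.1 * F tau.-1 p - Cs k p.1.
exists (fun i => if i == k then g else F i) => i t x.
rewrite ltnS leq_eqVlt => /orP[/eqP ->|ik].
  rewrite eqxx; congr (_ - _ - _); apply: eq_big_nat => tau /andP[t0 tk].
  by rewrite ifF //; lia.
rewrite ifF ?HF //; last by lia.
congr (_ - _ - _); apply: eq_big_nat => tau /andP[t0 tk].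
by rewrite ifF //; lia.
Qed.

Section Integrals.
Variables (K : nat -> nat -> Vt -> C) (Cs : nat -> Vt -> C).
Variable F : nat -> Vt * Vx -> C.
Hypothesis KC : KC_primitives f nu mu T' s K Cs.
Hypothesis F_rec : F_recursion nu mu T' X s K Cs F.
Notation D := (T' `*` X).

Let fstL : {linear (Vt * Vx)%type -> Vt} := fst.
Let sndL : {linear (Vt * Vx)%type -> Vx} := snd.

Lemma fst_continuous : continuous fstL.
Proof. by move=> p; exact: cvg_fst. Qed.

Lemma snd_continuous : continuous sndL.
Proof. by move=> p; exact: cvg_snd. Qed.

Lemma D_open : open D.
Proof.
have -> : D = (fst @^-1` T') `&` (snd @^-1` X) by [].
apply: openI; apply: open_comp => // p _; [exact: fst_continuous | exact: snd_continuous].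
Qed.

Lemma cC1_fst (g : Vt -> C) : cC1_on T' g -> cC1_on D (g \o fst).
Proof.
move=> Cg; have [Cr Ci] := cC1_comp_linear fst_continuous T'_open Cg.
by split=> p [Dp _]; [exact: Cr | exact: Ci].
Qed.

Lemma cC1_snd (g : Vx -> C) : cC1_on X g -> cC1_on D (g \o snd).
Proof.
move=> Cg; have [Cr Ci] := cC1_comp_linear snd_continuous X_open Cg.
by split=> p [_ Dp]; [exact: Cr | exact: Ci].
Qed.

Lemma cC1_C k : (k < s)%N -> cC1_on T' (Cs k).
Proof.
move=> ks.
have [] // := @triangular_primitives_C1 R m T' T'_sc s mu_plus source Cs _ _ _ k ks.
- by move=> j i _; exact: (cC1_mul T'_open (cC1_pairing_f (nu i) j) cC1_phi).
- move=> i is_ t T't; have [d Dd] := KC.2 i is_ t T't.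
  by split=> // j; rewrite Dd C_formE.
Qed.

Lemma unitri_primitive p k : (k < s)%N ->
  primitive_on T' (unitri K p k) (fun j t => 0 + conv (mu_plus j) (unitri K p ^~ t) k).
Proof.
move=> ks t T't; have [kp|pk] := leqP k p.
  have -> : unitri K p k = cst (k == p)%:R by apply/funext => t'; rewrite /unitri kp.
  have [d Dd] := has_cdiff_cst ((k == p)%:R : C) t; split=> // j.
  rewrite Dd add0r conv_lower // big1 // => i _; have ik := ltn_ord i.
  by rewrite /unitri ifT 1?(_ : (i == p :> nat) = false) ?mulr0 ?mul0r //; lia.
have -> : unitri K p k = K p k by apply/funext => t'; rewrite /unitri leqNgt pk.
have k0 : (0 < k < s)%N by lia.
have [d Dd] := KC.1 k p.+1 k0 (pk : (1 <= p.+1 <= k)%N) t T't.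
by split=> // j; rewrite Dd K_formE // add0r.
Qed.

Lemma cC1_K p k : (p < k)%N -> (k < s)%N -> cC1_on T' (K p k).
Proof.
move=> pk ks.
have -> : K p k = unitri K p k by apply/funext => t'; rewrite /unitri leqNgt pk.
have [] // := @triangular_primitives_C1 R m T' T'_sc s mu_plus (fun _ _ _ => 0)
  (unitri K p) _ _ _ k ks.
- by move=> j i _; exact: (cC1_cst T'_open 0).
- by move=> i is_; exact: unitri_primitive.
Qed.

Let E k (p : Vt * Vx) := pairing (nu k) p.2 * phi mu p.1 - Cs k p.1.
(** The j-th vector field of the system at (t, x). *)
Let dir j t x : Vt * Vx := (unitv j, (A j)^T *m x + f j t).

Lemma F_recE k p : (k < s)%N -> D p ->
  F k p = E k p - \sum_(i < k) K i k p.1 * F i p.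
Proof.
case: p => t x ks [/= T't Xx]; rewrite F_rec // big_add1 /= big_mkord /E /=.
by rewrite addrAC.
Qed.

(** The recursion of F solved for the known terms.  The summation range may be
    any N > k, since the coefficients of the later F_i are zero; a range common
    to all k is what the convolution in [F_C1_and_derive] needs. *)
Lemma E_sum k p N : (k < s)%N -> (k < N)%N -> D p ->
  E k p = \sum_(i < N) unitri K i k p.1 * F i p.
Proof.
move=> ks kN Dp; rewrite -(big_mkord xpredT (fun i => unitri K i k p.1 * F i p)).
rewrite (@big_cat_nat _ _ _ k.+1) //= [X in _ = _ + X]big_nat_cond.
rewrite [X in _ = _ + X]big1 ?addr0 => [|i]; last first.
  rewrite andbT => ik; rewrite /unitri ifT; last by lia.
  by rewrite (_ : (k == i) = false) ?mul0r //; lia.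
rewrite big_nat_recr //= /unitri leqnn eqxx mul1r F_recE //.
rewrite big_mkord addrCA -sumrB big1 ?addr0 // => i _.
by rewrite leqNgt ltn_ord subrr.
Qed.

Lemma cC1_E k : (k < s)%N -> cC1_on D (E k).
Proof.
move=> ks; apply: (cC1_add D_open); last first.
  by apply: (cC1_opp D_open); exact: (cC1_fst (cC1_C ks)).
apply: (cC1_mul D_open); last exact: (cC1_fst cC1_phi).
exact: (cC1_snd (cC1_pairing _ X_open)).
Qed.

(** The term mu_j0 l phi produced by differentiating l is cancelled by the
    derivative of phi, and nu f phi by the derivative of C. *)
Lemma derive_E k j t x : (k < s)%N -> D (t, x) ->
  cderive (E k) (dir j t x) (t, x) = conv (mu_plus j) (fun i => E i (t, x)) k.
Proof.
move=> ks [/= T't Xx].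
have dl : has_cdiff (pairing (nu k) \o sndL) (t, x) (pairing (nu k) \o sndL).
  exact: (has_cdiff_comp_linear snd_continuous (p := (t, x)) (has_cdiff_pairing (nu k) x)).
have dphi := has_cdiff_comp_linear fst_continuous (p := (t, x)) (has_cdiff_phi t).
have dC := has_cdiff_comp_linear fst_continuous (p := (t, x))
  (primitive_has_cdiff (KC.2 k ks) T't).
have [_ ->] := has_cdiff_add (has_cdiff_mul dl dphi) (has_cdiff_opp dC).
rewrite /= pairing_mu0_unitv cform_unitv C_formE pairingDr pairing_trmx A_nu // conv_mu.
by rewrite /E /= convDr convZr convNr /source; ring.
Qed.

Lemma F_C1_and_derive k : (k < s)%N -> cC1_on D (F k) /\
  forall j t x, D (t, x) -> cderive (F k) (dir j t x) (t, x) = 0.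
Proof.
elim/ltn_ind: k => k IH ks.
have CF : cC1_on D (F k).
  have CS : cC1_on D (fun p => \sum_(i < k) K i k p.1 * F i p).
    apply: (cC1_sum D_open) => i _; apply: (cC1_mul D_open).
      exact: (cC1_fst (cC1_K (ltn_ord i) ks)).
    by have [] := IH i (ltn_ord i) (ltn_trans (ltn_ord i) ks).
  have CG := cC1_add D_open (cC1_E ks) (cC1_opp D_open CS).
  by apply: (eq_cC1 D_open _ CG) => p Dp; rewrite F_recE.
split; first exact: CF.
move=> j t x Dtx; have [/= T't Xx] := Dtx.
have dE := has_cdiff_self (cC1_cdifferentiable (cC1_E ks) Dtx).
have dK (i : 'I_k) : has_cdiff (K i k \o fstL) (t, x)
    (cform (fun j t => 0 + conv (mu_plus j) (unitri K i ^~ t) k) t \o fstL).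
  have -> : K i k = unitri K i k.
    by apply/funext => t'; rewrite /unitri leqNgt ltn_ord.
  exact: (has_cdiff_comp_linear fst_continuous (p := (t, x))
    (primitive_has_cdiff (@unitri_primitive i k ks) T't)).
have dF (i : 'I_k) : has_cdiff (F i) (t, x) (cderive (F i) ^~ (t, x)).
  have [Ci _] := IH i (ltn_ord i) (ltn_trans (ltn_ord i) ks).
  exact: has_cdiff_self (cC1_cdifferentiable Ci Dtx).
have dS := has_cdiff_sum (index_enum 'I_k) (P := xpredT)
  (fun i _ => has_cdiff_mul (dK i) (dF i)).
have near_F : {near (t, x),
    (fun p => E k p + - \sum_(i < k) (K i k \o fstL) p * F i p) =1 F k}.
  by apply: (open_near D_open Dtx) => p Dp; rewrite F_recE.
have [_ ->] := eq_has_cdiff near_F (fun=> erefl) (has_cdiff_add dE (has_cdiff_opp dS)).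
rewrite derive_E // (@eq_conv_lower _ _ _
    (fun l => \sum_(i < k) unitri K i l t * F i (t, x))) //;
  last by move=> i ik; rewrite (@E_sum i (t, x) k) //; exact: ltn_trans ks.
rewrite conv_sumr -sumrB big1 // => i _.
have [_ ->] := IH i (ltn_ord i) (ltn_trans (ltn_ord i) ks) => //.
by rewrite convZr /= cform_unitv add0r mulr0 addr0 subrr.
Qed.

Lemma first_integrals k : (k < s)%N -> first_integral A f D (F k).
Proof.
move=> ks; have [CF dF] := F_C1_and_derive ks; split; first exact: CF.
move=> j t x Dtx; rewrite -[RHS](dF j t x Dtx).
have dFk := has_cdiff_self (cC1_cdifferentiable CF Dtx).
have lin := has_cdiff_linear dFk.
set y := (A j)^T *m x + f j t.
have add_ u u' : cderive (F k) (u + u') (t, x) =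
    cderive (F k) u (t, x) + cderive (F k) u' (t, x).
  by rewrite -[u]scale1r lin rmorph1 mul1r scale1r.
have zero_ : cderive (F k) 0 (t, x) = 0.
  by apply: (@addrI _ (cderive (F k) 0 (t, x))); rewrite -add_ !addr0.
have -> : dir j t x = (unitv j, 0) + \sum_(i < n) y i 0 *: (0, unitv i).
  rewrite -[X in _ = _ + X](_ : (0, \sum_(i < n) y i 0 *: unitv i) = _); last first.
    apply: (big_ind2 (fun a b => (0, a) = b)) => // [a b a' b' <- <-|i _].
      by congr (_, _); rewrite /= addr0.
    by congr (_, _); rewrite /= scaler0.
  congr (_, _); rewrite /= ?addr0 // add0r [LHS]matrix_sum_delta.
  by apply: eq_bigr => i _; rewrite big_ord1.
rewrite add_; congr (_ + _).
elim/big_rec2: _ => [|i z1 z2 _ ->]; first by rewrite zero_.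
by rewrite lin.
Qed.

End Integrals.

End FirstIntegrals.

Theorem theorem2p8 (R : realType) (m n : nat)
    (T : set 'cV[R]_m) (A : 'I_m -> 'M[R]_n)
    (f : 'I_m -> 'cV[R]_m -> 'cV[R]_n) (zeta : 'I_m)
    (nu : nat -> 'cV[R[i]]_n) (lambda : 'I_m -> R[i]) (s : nat)
    (X : set 'cV[R]_n) (v : nat -> 'cV[R]_n -> R) (T' : set 'cV[R]_m) :
  domain T ->
  (forall j, C1_on T (f j)) ->
  completely_solvable A f T ->
  (forall j, (size (elementary_divisors (cmx (A zeta))) <=
              size (elementary_divisors (cmx (A j))))%N) ->
  nu 0%N != 0 ->
  (forall j, cmx (A j) *m nu 0%N = lambda j *: nu 0%N) ->
  (2 <= s)%N ->
  ('X - (lambda zeta)%:P) ^+ s \in elementary_divisors (cmx (A zeta)) ->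
  generalized_eigenvectors (cmx (A zeta)) (lambda zeta) s nu ->
  domain X ->
  (forall x, X x -> pairing (nu 0%N) x != 0) ->
  (forall theta x, (1 <= theta < s)%N -> X x ->
     pairing (nu theta) x =
     \sum_(1 <= delta < theta.+1)
       'C(theta.-1, delta.-1)%:R * (v delta x)%:C *
       pairing (nu (theta - delta)%N) x) ->
  (forall j theta, j != zeta -> (1 <= theta < s)%N ->
     ~ ode_first_integral A X zeta (pop A j (v theta))) ->
  simply_connected_domain (R := R) T' ->
  T' `<=` T ->
  exists mu : 'I_m -> nat -> R[i],
    [/\ forall j, mu j 0%N = lambda j,
        forall j theta x, (1 <= theta < s)%N -> X x ->
          mu j theta = (pop A j (v theta) x)%:C,
        exists K C F, KC_primitives f nu mu T' s K C /\
                      F_recursion nu mu T' X s K C F &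
        forall K C F, KC_primitives f nu mu T' s K C ->
          F_recursion nu mu T' X s K C F ->
          forall theta, (theta < s)%N -> first_integral A f (T' `*` X) (F theta)].
Proof.
move=> _ f_C1 [A_comm solvable] _ _ nu0_eigen _ _ nu_gen [X_neq0 X_open _].
move=> nu0_neq0 v_rec no_integral T'_sc T'T.
have [x0 Xx0] := X_neq0.
pose mu := fun j => local_mu A lambda v j x0.
have f_C1' j : C1_on T' (f j) by move=> t /T'T; exact: f_C1.
have solvable' j z t : T' t -> 'D_(unitv z) (f j) t - (A z)^T *m f j t =
    'D_(unitv j) (f z) t - (A j)^T *m f z t by move=> /T'T; exact: solvable.
have A_nu j k y : (k < s)%N -> pairing (cmx (A j) *m nu k) y =
    conv (mu j) (fun i => pairing (nu i) y) k.
  exact: (pairing_A_nu A_comm nu0_eigen nu_gen X_open X_neq0 nu0_neq0 v_rec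
    no_integral _ _ Xx0).
exists mu; split=> //.
- move=> j [//|k] x /= ks Xx; congr (_%:C).
  exact: (pop_v_constant A_comm nu0_eigen nu_gen X_open nu0_neq0 v_rec no_integral).
- have [K [Cs KC]] := KC_exist T'_sc f_C1' solvable' A_nu.
  by have [F FR] := F_exist T' X nu mu s K Cs; exists K, Cs, F.
- move=> K Cs F KC FR k ks.
  exact: (first_integrals T'_sc X_open f_C1' A_nu KC FR ks).
Qed.
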